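(* Let $K$ be an infinite field with $\mathrm{char}\,K=p>0$, $r\ge1$, and $\lambda=(\lambda_1,\lambda_2)\in\Lambda(2,r)$ with $\lambda_2\neq0$. Then the sequence of left $S(B^+,2,r)$-modules $$0\to U_\lambda\xrightarrow{\ f\ }E(\lambda)\xrightarrow{\ g\ }K_\lambda\to0,$$ where $f(z)=(z,0)$ and $g(z',c)=c$ for all $z\in U_\lambda$, $(z',c)\in E(\lambda)$, is an Auslander-Reiten sequence.
   Context: Multi-indices ($n=2$). $I(2,r)=\{1,2\}^r$; $\Lambda(2,r)$ is the set of pairs of non-negative integers with sum $r$. $\Sigma_r$ acts on the right on $I(2,r)$ by $i\pi=(i_{\pi1},\dots,i_{\pi r})$ and diagonally on pairs; $\sim$ means ''in the same orbit''. $i\le j$ means $i_\rho\le j_\rho$ for all $\rho$. $l=l(\lambda)=(1^{\lambda_1},2^{\lambda_2})$. For $0\le m\le\lambda_2$, $\lambda(1,m)=(\lambda_1+m,\lambda_2-m)$ and $l(1,m)=l(\lambda(1,m))$. $T^\lambda_i$ is the two-row tableau with row lengths $\lambda_1,\lambda_2$ filled with $i_1,\dots,i_r$ row by row; it is row-semistandard if its rows weakly increase. $J(\lambda)=\{j\in I(2,r): j\ge l(\lambda),\ T^\lambda_j\text{ row-semistandard}\}$ (for any composition). Algebra. $S(B^+)=S(B^+,2,r)$ is the image of $KB^+$ in $\mathrm{End}_K((K^2)^{\otimes r})$ (diagonal action), $B^+$ the group of upper triangular matrices in $\mathrm{GL}_2(K)$. With $e_i=e_{i_1}\otimes\dots\otimes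 e_{i_r}$, $\xi_{i,j}$ is the endomorphism $e_k\mapsto\sum_{h:(h,k)\sim(i,j)}e_h$; $\xi_{i,j}=\xi_{k,h}$ iff $(i,j)\sim(k,h)$, and the distinct $\xi_{i,j}$ with $i\le j$ form a basis of $S(B^+)$. $\xi_\alpha:=\xi_{l(\alpha),l(\alpha)}$. $K_\lambda$ is the one-dimensional left $S(B^+)$-module $K$ on which $\xi_\lambda$ acts as identity and all other basis elements act as zero. Let $d\ge0$ with $p^d\le\lambda_2<p^{d+1}$. Put $P_0^t=\xi_\lambda S(B^+)$, $P_1^t=\bigoplus_{d'=0}^d\xi_{\lambda(1,p^{d'})}S(B^+)$ (right modules) and $p_1^t\colon P_0^t\to P_1^t$, $p_1^t(\eta)=\sum_{d'=0}^d\xi_{l(1,p^{d'}),l}\,\eta$. For $j\in J(\lambda)$ let $a(j)$ be the number of $2$'s in the first row of $T^\lambda_j$, with $p$-adic expansion $a(j)=\sum_t a_tp^t$. Let $\hat J(\lambda)$ be the set of $j\in J(\lambda)$ with $a_t\ne p-1$ for some $0\le t\le d$; for such $j$ let $m(j)=\min\{t\le d: a_t<p-1\}$; $\hat J(\lambda,d')=\{j\in\hat J(\lambda): m(j)=d'\}$. The set $\overline B_2=\{\xi_{l(1,p^{d'}),j}: j\in J(\lambda(1,p^{d'}))\setminus\hat J(\lambda,d'),\ 0\le d'\le d\}\cup\{p_1^t(\xi_{l,j}): j\in\hat J(\lambda)\}$ is a $K$-basis of $P_1^t$. Let $DP_1^t=\mathrm{Hom}_K(P_1^t,K)$, a left module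 via $(\xi\psi)(x)=\psi(x\xi)$; let $B_2^*$ be its basis dual to $\overline B_2$, and $z_{l,j}$ ($j\in\hat J(\lambda)$) the element dual to $p_1^t(\xi_{l,j})$. $U_\lambda$ is the $S(B^+)$-submodule of $DP_1^t$ with $K$-basis $B_2^*\setminus\{z_{l,j}: j\in\hat J(\lambda)\}$, and $E(\lambda)=\{(z,c)\in DP_1^t\oplus K_\lambda: z\in U_\lambda+c\,z_{l,l}\}$. A short exact sequence $0\to N\xrightarrow{f}E\xrightarrow{g}S\to0$ of finite-dimensional modules is Auslander-Reiten if it is not split, $S$ and $N$ are indecomposable, and for every indecomposable module $X$ every non-invertible homomorphism $h\colon X\to S$ factors through $g$. *)

(* Defs.v *)
From HB Require Import structures.
From mathcomp Require Import all_boot all_order all_fingroup all_algebra.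
From mathcomp Require Import boolp.
From mathcomp Require classical_sets cardinality.

Set Implicit Arguments.
Unset Strict Implicit.
Unset Printing Implicit Defensive.

Import GRing.Theory.
Local Open Scope ring_scope.

Section LinearAlgebra.
Variable K : fieldType.

Lemma linfunE (aT rT : vectType K) (f : aT -> rT) :
  linear f -> linfun f =1 f.
Proof.
move=> linf; pose fM := GRing.isLinear.Build _ _ _ _ f linf.
pose f' : {linear aT -> rT} := HB.pack f fM.
exact: (lfunE f').
Qed.

Lemma span_pred_exists (vT : vectType K) (P : vT -> Prop) :
  exists W : {vspace vT}, forall v, v \in W <->
    exists2 X : seq vT, (forall x, x \in X -> P x) & v \in <<X>>%VS.
Proof.
pose Q (n : nat) := `[< exists2 X : seq vT, forall x, x \in X -> P x
                                  & \dim <<X>>%VS = n >].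
have Q0 : exists n, Q n.
  by exists 0; apply/asboolP; exists [::]; rewrite // span_nil dimv0.
have Qmax n : Q n -> (n <= \dim {:vT})%N.
  by move=> /asboolP[X _ <-]; exact/dimvS/subvf.
case: (ex_maxnP Q0 Qmax) => n /asboolP[X PX dimX] maxn.
exists <<X>>%VS => v; split=> [Xv | [Y PY Yv]]; first by exists X.
have PXY x : x \in X ++ Y -> P x by rewrite mem_cat => /orP[/PX | /PY].
have sXXY : (<<X>> <= <<X ++ Y>>)%VS by rewrite span_cat addvSl.
have : (<<X>> == <<X ++ Y>>)%VS.
  rewrite -(geq_leqif (dimv_leqif_eq sXXY)) dimX maxn //.
  by apply/asboolP; exists (X ++ Y).
by move/eqP->; rewrite span_cat; apply: subvP Yv; rewrite addvSr.
Qed.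

(* The K-linear span of a possibly infinite set of vectors. *)
Definition span_pred (vT : vectType K) (P : vT -> Prop) : {vspace vT} :=
  projT1 (cid (span_pred_exists P)).

Lemma mem_span_pred (vT : vectType K) (P : vT -> Prop) v :
  v \in span_pred P <->
    exists2 X : seq vT, (forall x, x \in X -> P x) & v \in <<X>>%VS.
Proof. exact: (projT2 (cid (span_pred_exists P))). Qed.

Definition lcomp (aT bT cT : vectType K) (f : 'Hom(bT, cT)) :
  'Hom('Hom(aT, bT), 'Hom(aT, cT)) := linfun (fun h => (f \o h)%VF).

Lemma lcompE (aT bT cT : vectType K) (f : 'Hom(bT, cT)) (h : 'Hom(aT, bT)) :
  lcomp aT f h = (f \o h)%VF.
Proof. by rewrite linfunE // => c u v; rewrite comp_lfunDr comp_lfunZr. Qed.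

Definition rcomp (aT bT cT : vectType K) (f : 'Hom(aT, bT)) :
  'Hom('Hom(bT, cT), 'Hom(aT, cT)) := linfun (fun h => (h \o f)%VF).

Lemma rcompE (aT bT cT : vectType K) (f : 'Hom(aT, bT)) (h : 'Hom(bT, cT)) :
  rcomp cT f h = (h \o f)%VF.
Proof. by rewrite linfunE // => c u v; rewrite comp_lfunDl comp_lfunZl. Qed.

(* For a family b that is a basis of the whole space vT, dual_vec b t is the
   linear form with value 1 at b t and 0 at b s for s <> t. *)
Definition dual_vec (vT : vectType K) (T : finType) (b : T -> vT) (t : T) :
  'Hom(vT, K^o) :=
  linfun (coord [tuple b (enum_val k) | k < #|T|] (enum_rank t) : vT -> K^o).

Lemma dual_vecE (vT : vectType K) (T : finType) (b : T -> vT) (t s : T) :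
  free [tuple b (enum_val k) | k < #|T|] ->
  dual_vec b t (b s) = (t == s)%:R.
Proof.
move=> fb; rewrite lfunE /=.
have -> : b s = [tuple b (enum_val k) | k < #|T|]`_(enum_rank s).
  by rewrite -(tnth_nth 0) tnth_mktuple enum_rankK.
by rewrite coord_free // (inj_eq enum_rank_inj) eq_sym.
Qed.

Definition ffun_proj (vT : vectType K) (T : finType) (t : T) :
  'Hom({ffun T -> vT}, vT) := linfun (fun x : {ffun T -> vT} => x t).

Lemma ffun_projE (vT : vectType K) (T : finType) (t : T) (x : {ffun T -> vT}) :
  ffun_proj vT t x = x t.
Proof. by rewrite linfunE // => c u v; rewrite !ffunE. Qed.

(* The external direct sum of the subspaces W t of vT. *)
Definition dsum_vspace (vT : vectType K) (T : finType) (W : T -> {vspace vT}) :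
  {vspace {ffun T -> vT}} := (\bigcap_t (ffun_proj vT t @^-1: W t))%VS.

Lemma mem_dsum_vspace (vT : vectType K) (T : finType) (W : T -> {vspace vT}) x :
  (x \in dsum_vspace W) = [forall t, x t \in W t].
Proof.
apply/idP/forallP=> [Wx t | Wx].
  move: Wx; rewrite /dsum_vspace (bigD1 t) //= memv_cap => /andP[+ _].
  by rewrite -memv_preim ffun_projE.
rewrite /dsum_vspace; elim/big_ind: _ => [|U U' xU xU'|t _].
- exact: memvf.
- by rewrite memv_cap xU.
- by rewrite -memv_preim ffun_projE.
Qed.

Definition ffun_inj (vT : vectType K) (T : finType) (t : T) (v : vT) :
  {ffun T -> vT} := [ffun s => if s == t then v else 0].

End LinearAlgebra.

(* Finite-dimensional left modules over a unital subalgebra A of End_K(V),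
   where the product of A is composition.  Only the restriction of act to A is
   meaningful. *)
Section Modules.
Variables (K : fieldType) (V : vectType K).

Record actType := Act { car :> vectType K; act : 'End(V) -> 'End(car) }.

Variable A : {vspace 'End(V)}.

Definition is_lmod (M : actType) : Prop :=
  [/\ forall (c : K) (a b : 'End(V)), a \in A -> b \in A ->
        act M (c *: a + b) = c *: act M a + act M b,
      act M \1%VF = \1%VF
    & forall a b : 'End(V), a \in A -> b \in A ->
        act M (a \o b)%VF = (act M a \o act M b)%VF].

Definition is_submod (M : actType) (W : {vspace M}) : Prop :=
  forall a : 'End(V), a \in A -> (act M a @: W <= W)%VS.

Definition is_lmod_hom (M N : actType) (h : 'Hom(M, N)) : Prop :=
  forall a : 'End(V), a \in A -> (h \o act M a = act N a \o h)%VF.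

Definition is_lmod_iso (M N : actType) (h : 'Hom(M, N)) : Prop :=
  is_lmod_hom h /\
  exists k : 'Hom(N, M),
    [/\ is_lmod_hom k, (k \o h = \1)%VF & (h \o k = \1)%VF].

Definition indecomposable (M : actType) : Prop :=
  (fullv : {vspace M}) <> 0%VS /\
  forall W1 W2 : {vspace M}, is_submod W1 -> is_submod W2 ->
    (W1 + W2 = fullv)%VS -> (W1 :&: W2 = 0)%VS -> W1 = 0%VS \/ W2 = 0%VS.

Definition short_exact (N E S : actType)
    (f : 'Hom(N, E)) (g : 'Hom(E, S)) : Prop :=
  [/\ [/\ is_lmod N, is_lmod E & is_lmod S],
      is_lmod_hom f, is_lmod_hom g
    & [/\ lker f = 0%VS, limg f = lker g & limg g = fullv]].

Definition splits (E S : actType) (g : 'Hom(E, S)) : Prop :=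
  exists s : 'Hom(S, E), is_lmod_hom s /\ (g \o s = \1)%VF.

Definition auslander_reiten (N E S : actType)
    (f : 'Hom(N, E)) (g : 'Hom(E, S)) : Prop :=
  [/\ short_exact f g,
      ~ splits g,
      indecomposable S,
      indecomposable N
    & forall X : actType, is_lmod X -> indecomposable X ->
      forall h : 'Hom(X, S), is_lmod_hom h -> ~ is_lmod_iso h ->
      exists k : 'Hom(X, E), is_lmod_hom k /\ h = (g \o k)%VF].

(* For a submodule W, vsproj W is applied to elements of W only, so that this is
   the restriction of the action of M to W. *)
Definition submod (M : actType) (W : {vspace M}) : actType :=
  Act (fun a => linfun (fun u : subvs_of W => vsproj W (act M a (vsval u)))).

Lemma submodE (M : actType) (W : {vspace M}) (a : 'End(V)) (u : subvs_of W) :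
  act (submod W) a u = vsproj W (act M a (vsval u)).
Proof. by rewrite /= linfunE // => c x y; rewrite !linearP. Qed.

Definition dsum_mod (M N : actType) : actType :=
  @Act (M * N)%type
    (fun a => linfun (fun x : M * N => (act M a x.1, act N a x.2))).

Lemma dsum_modE (M N : actType) (a : 'End(V)) (x : M * N) :
  act (dsum_mod M N) a x = (act M a x.1, act N a x.2).
Proof. by rewrite /= linfunE // => c y z /=; rewrite !linearP. Qed.

End Modules.

Section MultiIndices.
Variable r : nat.

(* I(2,r); the entries 1 and 2 are encoded as 0 and 1 in 'I_2. *)
Definition mindex := {ffun 'I_r -> 'I_2}.
Definition one_ : 'I_2 := ord0.
Definition two_ : 'I_2 := ord_max.

Definition iact (i : mindex) (s : 'S_r) : mindex := [ffun rho => i (s rho)].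

Definition orb_eq (x y : mindex * mindex) : bool :=
  [exists s : 'S_r, (iact x.1 s == y.1) && (iact x.2 s == y.2)].

Definition ile (i j : mindex) : bool := [forall rho, (i rho <= j rho)%N].

Definition lidx (la : nat * nat) : mindex :=
  [ffun rho : 'I_r => if (rho < la.1)%N then one_ else two_].

(* The positions rho < la.1 form the first row of the tableau T^la_i, the other
   ones form the second row. *)
Definition row_semistandard (la : nat * nat) (i : mindex) : bool :=
  [forall rho : 'I_r, forall sigma : 'I_r,
    ((rho <= sigma) && ((rho < la.1) == (sigma < la.1)) ==>
      (i rho <= i sigma))%N].

Definition Jset (la : nat * nat) : {set mindex} :=
  [set j | ile (lidx la) j && row_semistandard la j].

Definition atwo (la : nat * nat) (j : mindex) : nat :=
  #|[set rho : 'I_r | (rho < la.1)%N && (j rho == two_)]|.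

Definition digit (p a t : nat) : nat := (a %/ p ^ t %% p)%N.

Definition Jhat (p d : nat) (la : nat * nat) : {set mindex} :=
  [set j in Jset la | [exists t : 'I_d.+1, digit p (atwo la j) t != p.-1]].

(* The least t <= d with a_t < p - 1; equal to d + 1 if there is none. *)
Definition mmin (p d : nat) (la : nat * nat) (j : mindex) : nat :=
  find (fun t => digit p (atwo la j) t < p.-1)%N (iota 0 d.+1).

Definition Jhat_at (p d : nat) (la : nat * nat) (d' : nat) : {set mindex} :=
  [set j in Jhat p d la | mmin p d la j == d'].

End MultiIndices.

Definition la1 (la : nat * nat) (m : nat) : nat * nat :=
  (la.1 + m, la.2 - m)%N.

Section BorelSchur.
Variables (K : fieldType) (r : nat).

(* The tensor power (K^2)^{\otimes r}, given by coordinates with respect to the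
   basis of the e_i with i in I(2,r). *)
Definition tens : vectType K := {ffun mindex r -> K^o}.

Definition evec (i : mindex r) : tens := [ffun h => (h == i)%:R].

(* The endomorphism e_k |-> \sum_h a h k e_h. *)
Definition mx_end (a : mindex r -> mindex r -> K) : 'End(tens) :=
  linfun (fun v : tens => [ffun h => \sum_k a h k * v k] : tens).

Lemma mx_endE a (v : tens) h : mx_end a v h = \sum_k a h k * v k.
Proof.
rewrite linfunE ?ffunE // => c u w; apply/ffunP => x.
rewrite !ffunE scaler_sumr -big_split /=.
by apply: eq_bigr => k _; rewrite !ffunE mulrDr [in LHS]mulrCA.
Qed.

Lemma mx_end_evec a k : mx_end a (evec k) = \sum_h a h k *: evec h.
Proof.
apply/ffunP => x; rewrite mx_endE sum_ffunE.
rewrite (bigD1 k) //= [RHS](bigD1 x) //= !ffunE !eqxx.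
rewrite !big1 => [//|h hx|h hk]; first by rewrite !ffunE eq_sym (negPf hx) scaler0.
by rewrite ffunE (negPf hk) mulr0.
Qed.

Definition xi (i j : mindex r) : 'End(tens) :=
  mx_end (fun h k => (orb_eq (h, k) (i, j))%:R).

(* The diagonal action of g: the vector
   g e_{k_1} \otimes ... \otimes g e_{k_r} expanded in the basis e_h. *)
Definition tens_act (g : 'M[K]_2) : 'End(tens) :=
  mx_end (fun h k => \prod_(rho < r) g (h rho) (k rho)).

(* is_trig_mx means lower triangular. *)
Definition borel (g : 'M[K]_2) : bool := (g \in unitmx) && is_trig_mx g^T.

Definition SB : {vspace 'End(tens)} :=
  span_pred (fun s => exists2 g : 'M[K]_2, borel g & s = tens_act g).

Definition xila (la : nat * nat) : 'End(tens) := xi (lidx r la) (lidx r la).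

Definition SB_basis : seq 'End(tens) :=
  undup [seq xi x.1 x.2 | x in [set x : mindex r * mindex r | ile x.1 x.2]].

(* The linear form with value 1 at xi_la and 0 at the other elements of the
   basis SB_basis of SB. *)
Definition Kla_char (la : nat * nat) (s : 'End(tens)) : K :=
  \sum_(k < size SB_basis)
     coord (in_tuple SB_basis) k s * (SB_basis`_k == xila la)%:R.

Definition Kla (la : nat * nat) : actType tens :=
  @Act K tens K^o (fun s => Kla_char la s *: \1%VF).

(* The right ideal x SB. *)
Definition rideal (x : 'End(tens)) : {vspace 'End(tens)} := (lcomp _ x @: SB)%VS.

Variables (p d : nat) (la : nat * nat).

Definition P1 : {vspace {ffun 'I_d.+1 -> 'End(tens)}} :=
  dsum_vspace (fun d' : 'I_d.+1 => rideal (xila (la1 la (p ^ d')))).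

Definition P1_ract (s : 'End(tens)) : 'End(subvs_of P1) :=
  linfun (fun x : subvs_of P1 =>
            vsproj P1 [ffun d' : 'I_d.+1 => (vsval x d' \o s)%VF]).

Lemma P1_ractE s (x : subvs_of P1) :
  P1_ract s x =
  vsproj P1 [ffun d' : 'I_d.+1 => (vsval x d' \o s)%VF].
Proof.
rewrite linfunE // => c u v; rewrite -linearP /=; congr vsproj.
by apply/ffunP => t; rewrite !ffunE comp_lfunDl comp_lfunZl.
Qed.

(* Only applied to elements of xi_la SB, which it maps into P1. *)
Definition p1t (eta : 'End(tens)) : subvs_of P1 :=
  vsproj P1
    [ffun d' : 'I_d.+1 => (xi (lidx r (la1 la (p ^ d'))) (lidx r la) \o eta)%VF].

(* The indices of the elements of B_2 in the two sets of its definition. *)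
Definition B2_left : finType :=
  {x : 'I_d.+1 * mindex r
     | x.2 \in Jset r (la1 la (p ^ x.1)) :\: Jhat_at r p d la x.1}.
Definition B2_right : finType := {j : mindex r | j \in Jhat r p d la}.

Definition B2 (t : B2_left + B2_right) : subvs_of P1 :=
  match t with
  | inl x => let: (d', j) := val x in
      vsproj P1 (ffun_inj d' (xi (lidx r (la1 la (p ^ d'))) j))
  | inr j => p1t (xi (lidx r la) (val j))
  end.

Definition DP1 : actType tens :=
  @Act K tens 'Hom(subvs_of P1, K^o) (fun s => rcomp K^o (P1_ract s)).

(* z_{l,j}, extended by 0 to the indices j outside Jhat(la). *)
Definition zvec (j : mindex r) : DP1 :=
  if insub j is Some x then dual_vec B2 (inr (x : B2_right)) else 0.

Definition Uspace : {vspace DP1} :=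
  <<[seq dual_vec B2 (inl x) | x : B2_left]>>%VS.

Definition U_ : actType tens := submod Uspace.

Definition DPK : actType tens := dsum_mod DP1 (Kla la).

Definition Espace : {vspace DPK} :=
  (linfun (fun x : DPK => x.1 - (x.2 : K) *: zvec (lidx r la)) @^-1: Uspace)%VS.

Lemma mem_Espace (x : DPK) :
  (x \in Espace) = (x.1 - (x.2 : K) *: zvec (lidx r la) \in Uspace).
Proof.
rewrite -memv_preim linfunE // => c u v /=.
by rewrite scalerBr scalerDl opprD addrACA scalerA.
Qed.

Definition E_ : actType tens := submod Espace.

Definition fmap : 'Hom(U_, E_) :=
  linfun (fun z : subvs_of Uspace => vsproj Espace (vsval z, 0 : K^o)).

Definition gmap : 'Hom(E_, Kla la) :=
  linfun (fun x : subvs_of Espace => (vsval x).2).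

Lemma fmapE (z : subvs_of Uspace) : fmap z = vsproj Espace (vsval z, 0 : K^o).
Proof.
rewrite linfunE // => c u v; rewrite -linearP /=; congr vsproj.
by congr pair; rewrite /= ?linearP // scaler0 addr0.
Qed.

Lemma gmapE (x : subvs_of Espace) : gmap x = (vsval x).2.
Proof. by rewrite linfunE. Qed.

End BorelSchur.

(* Main.v *)
Require Import Defs.
From HB Require Import structures.
From mathcomp Require Import all_boot all_order all_fingroup all_algebra.
From mathcomp Require Import boolp zify ring.
From mathcomp Require classical_sets cardinality.

Import GRing.Theory.
Local Open Scope ring_scope.

Set Implicit Arguments.
Unset Strict Implicit.
Unset Printing Implicit Defensive.

(* Group actions also use the name [act]. *)
Local Notation act := Defs.act.

(** The algebra has a basis [E t s], [t <= s <= r], where [E t s] maps the weight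
    space with [s] entries 2 to the one with [t] entries 2 by turning [s - t]
    of the 2's into 1's in all possible ways: it is a divided power of the
    raising operator, so that the product of [E t s] and [E s u] is
    ['C(u - t, s - t)] times [E t u]. All of the theorem is read off from these
    structure constants.

    Write [n] for the second part of the weight and [wt e = n - p ^ e]. A linear
    form on [P1] is given by its coordinates at the elements [E (wt e) s] of the
    [e]-th summand, and [E t s] acts on these coordinates diagonally, by binomial
    coefficients. In the coordinates, the submodule [U] consists of the forms that
    vanish on the image of [p1t], because the elements of the basis [B2] that lie
    in the image of [p1t] span this image ([mem_U], [mem_UP]). Likewise the middle
    term consists of the pairs [(psi, c)] for which the composite of [psi] and
    [p1t] is [c] times the coordinate at [E n n] ([mem_EP]). Hence both are
    submodules, and the sequence is exact.

    The arithmetic enters through ['C(N, p ^ e) = N %/ p ^ e] in [K] ([bin_pexp]).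
    It shows that [E (wt e) n] sees only the [e]-th coordinate in weight [n]
    ([act_E_n]), and that every [E m n] with [m < n] is a left multiple of some
    [E (wt e) n] with [e <= d] ([E_factor]). Three consequences finish the proof.

    The sequence does not split: a section gives a form [psi] of weight [n] that
    is killed by all [E (wt e) n], so that its coordinates in weight [n] vanish,
    while their sum is [psi (p1t (E n n)) = 1] ([not_splits]).

    The module [U] is indecomposable: the socle of [U] has the basis [delta e],
    one vector in each weight [wt e]. A module endomorphism of [U] scales each
    [delta e] by some [c e], and applied to a vector of weight [n] with
    coordinates 1 at [e], -1 at [e'] and 0 elsewhere it gives [c e = c e']. So a
    projection of [U] onto a direct summand is a scalar on the socle; as every
    nonzero submodule meets the socle, one of the two summands is zero
    ([U_indecomposable]).

    A homomorphism [h] from [X] to the simple module lifts: a vector of [X]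
    killed by all [E (wt e) n] on which [h] does not vanish has a component of
    weight [n] spanning a complement of the kernel of [h], by [E_factor]
    ([vanish_on_killed]). If [X] is indecomposable and [h] is not invertible,
    there is no such vector, and [h] factors through the linear map
    [x |-> (E (wt e) n x)_e]; the second factor [theta] defines the lift, whose
    first component sends [x] to the form [v |-> theta (v_e x)_e]
    ([lift_through_g]). *)

(** * Multi-indices with entries 1 and 2 as sets of positions *)

Section TwoSets.
Variable r : nat.
Implicit Types (h i j k : mindex r) (A B : {set 'I_r}).

Definition twos (i : mindex r) : {set 'I_r} := [set rho | i rho == two_].

Definition of_twos A : mindex r := [ffun rho => if rho \in A then two_ else one_].

Lemma twosK : cancel twos of_twos.
Proof.
move=> i; apply/ffunP => rho; rewrite ffunE inE.
by case: (i rho) => [[|[|m]] Hm] //; apply/val_inj.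
Qed.

Lemma of_twosK : cancel of_twos twos.
Proof. by move=> A; apply/setP => rho; rewrite inE ffunE; case: (rho \in A). Qed.

Lemma twos_inj : injective twos.
Proof. exact: can_inj twosK. Qed.

Lemma ile_subset i j : ile i j = (twos i \subset twos j).
Proof.
apply/forallP/subsetP => [le_ij rho | sub_ij rho].
  rewrite !inE => /eqP i2; move: (le_ij rho); rewrite i2 /=.
  by case: (j rho) => [[|[|m]] Hm] //= _.
have := sub_ij rho; rewrite !inE.
by case: (i rho) (j rho) => [[|[|m]] Hm] [[|[|m']] Hm'] //= /(_ isT).
Qed.

Lemma mem_twos_lidx la rho : (rho \in twos (lidx r la)) = (la.1 <= rho)%N.
Proof. by rewrite inE ffunE; case: ltnP. Qed.

Lemma card_twos_le i : (#|twos i| <= r)%N.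
Proof. by rewrite -[X in (_ <= X)%N]card_ord max_card. Qed.

Lemma card_twos_lidx la : #|twos (lidx r la)| = (r - la.1)%N.
Proof.
rewrite -sum1_card (eq_bigl (fun rho : 'I_r => leq la.1 rho)); last first.
  exact: mem_twos_lidx.
rewrite -(big_mkord (leq la.1) (fun=> 1%N)).
by rewrite -(@big_nat_widenl _ _ _ la.1 0 _ xpredT) // sum_nat_const_nat muln1.
Qed.

(** The weakly increasing multi-index with [s] entries equal to 2. *)
Definition std (s : nat) : mindex r := lidx r (r - s, s)%N.

Lemma card_std s : (s <= r)%N -> #|twos (std s)| = s.
Proof. by move=> le_sr; rewrite card_twos_lidx subKn. Qed.

Lemma lidx_std la : (la.1 <= r)%N -> lidx r la = std (r - la.1).
Proof. by move=> le_r; apply/ffunP => rho; rewrite !ffunE /= subKn. Qed.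

Lemma std_ile s t : (s <= t)%N -> ile (std s) (std t).
Proof.
move=> le_st; rewrite ile_subset; apply/subsetP => rho.
by rewrite !mem_twos_lidx /=; lia.
Qed.

Definition upclosed (j : mindex r) :=
  forall rho sigma : 'I_r, (rho <= sigma)%N -> rho \in twos j -> sigma \in twos j.

Lemma upclosed_std s : upclosed (std s).
Proof. by move=> rho sigma; rewrite !mem_twos_lidx /= => ? ?; lia. Qed.

(** Up-closed subsets of a chain are linearly ordered by inclusion, so that
    their size determines them. *)
Lemma upclosed_inj i j : upclosed i -> upclosed j -> #|twos i| = #|twos j| -> i = j.
Proof.
move=> mi mj eq_ij; apply: twos_inj.
have [sij|/subsetPn[x xi xj]] := boolP (twos i \subset twos j).
  by apply/eqP; rewrite eqEcard sij eq_ij leqnn.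
have sji : twos j \subset twos i.
  apply/subsetP => y yj; apply: mi xi; rewrite leqNgt; apply: contra xj => lt_yx.
  exact: mj (ltnW lt_yx) yj.
by apply/esym/eqP; rewrite eqEcard sji eq_ij leqnn.
Qed.

(** For [j >= l] the second row of the tableau is filled with 2's, so that
    row-semistandard means weakly increasing as a word. Hence the set [J] of any
    composition is a set of words [std s]. *)
Lemma mem_Jset la j : (la.1 <= r)%N ->
  (j \in Jset r la) = (j == std #|twos j|) && (r - la.1 <= #|twos j|)%N.
Proof.
move=> le_r; apply/idP/andP => [|[/eqP def_j le_j]].
  rewrite inE ile_subset => /andP[/subsetP ile_j /forallP rss].
  split; last first.
    by rewrite -card_twos_lidx subset_leq_card //; apply/subsetP.
  apply/eqP/upclosed_inj; [|exact: upclosed_std|by rewrite card_std // card_twos_le].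
  move=> rho sigma le_rs rj.
  case: (ltnP sigma la.1) => [lt_s|]; last by rewrite -mem_twos_lidx; apply: ile_j.
  have lt_rho : (rho < la.1)%N by apply: leq_ltn_trans lt_s.
  move/forallP: (rss rho) => /(_ sigma); rewrite le_rs lt_s lt_rho /=.
  move: rj; rewrite !inE => /eqP ->.
  by case: (j sigma) => [[|[|m]] Hm] //= _.
rewrite inE; apply/andP; split.
  by rewrite def_j lidx_std // std_ile.
apply/forallP => rho; apply/forallP => sigma; apply/implyP => /andP[le_rs _].
have := @upclosed_std #|twos j| _ _ le_rs; rewrite -def_j !inE.
by case: (j rho) (j sigma) => [[|[|m]] Hm] [[|[|m']] Hm'] //= /(_ isT).
Qed.

Lemma std_in_Jset la s : (la.1 <= r)%N -> (s <= r)%N ->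
  (std s \in Jset r la) = (r - la.1 <= s)%N.
Proof. by move=> le_la le_s; rewrite mem_Jset // card_std // eqxx. Qed.

Lemma atwo_std la s : (la.1 <= r)%N -> (r - la.1 <= s <= r)%N ->
  atwo la (std s) = (s - (r - la.1))%N.
Proof.
move=> le_la /andP[le_s s_le].
have sub : twos (lidx r la) \subset twos (std s).
  by rewrite -ile_subset lidx_std // std_ile.
have := cardsID (twos (lidx r la)) (twos (std s)).
rewrite (setIidPr sub) card_twos_lidx card_std // => def_s.
rewrite -[in RHS]def_s addKn; apply: eq_card => rho.
by rewrite in_setD mem_twos_lidx -ltnNge !in_set.
Qed.

(** A pair of multi-indices with [ile h k] has the entries (1,1), (1,2) and
    (2,2), whose multiplicities are fixed by the two numbers of 2's; the
    symmetric group permutes the pairs with given multiplicities transitively. *)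
Lemma orb_eq_ile h k i j : ile i j ->
  orb_eq (h, k) (i, j) =
  [&& ile h k, #|twos h| == #|twos i| & #|twos k| == #|twos j|].
Proof.
move=> le_ij; apply/existsP/and3P => [|].
  case=> s /= /andP[/eqP def_i /eqP def_j]; subst i j.
  have card_act m : #|twos (iact m s)| = #|twos m|.
    rewrite -(card_preimset (twos m) (@perm_inj _ s)).
    by apply: eq_card => rho; rewrite !inE ffunE.
  rewrite !card_act !eqxx; split=> //.
  apply/forallP => rho; move/forallP: le_ij => /(_ (s^-1 rho)%g).
  by rewrite !ffunE permKV.
move=> [le_hk /eqP card_h /eqP card_k].
pose val2 (x : mindex r * mindex r) := [tuple (x.1 rho, x.2 rho) | rho < r].
have count_val2 x c : ile x.1 x.2 -> count_mem c (val2 x) =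
    if c.1 == two_ then if c.2 == two_ then #|twos x.1| else 0%N
    else if c.2 == two_ then (#|twos x.2| - #|twos x.1|)%N
    else (r - #|twos x.2|)%N.
  rewrite ile_subset => sub12.
  have -> : count_mem c (val2 x) = #|[set rho | (x.1 rho, x.2 rho) == c]|.
    rewrite cardsE cardE size_filter count_map.
    by rewrite [tval (ord_tuple r)]val_ord_tuple enumT; apply: eq_count.
  have notwo (i0 : 'I_2) : (i0 != two_) = (i0 == one_) by case: i0 => [[|[|]]].
  case: c => a b /=; case: (eqVneq a two_) => [->|]; last first.
    rewrite notwo => /eqP ->; case: (eqVneq b two_) => [->|].
      rewrite -cardsDS //; apply: eq_card => rho.
      by rewrite !inE xpair_eqE notwo.
    rewrite notwo => /eqP ->.
    have -> : (r - #|twos x.2|)%N = #|~: twos x.2|.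
      by rewrite [RHS]cardsCs setCK card_ord.
    apply: eq_card => rho; rewrite !inE xpair_eqE -!notwo.
    move/subsetP: sub12 => /(_ rho); rewrite !inE.
    by case: (x.1 rho == _) => [->|] //.
  have [->|] := eqVneq b two_.
    apply: eq_card => rho; rewrite !inE xpair_eqE.
    move/subsetP: sub12 => /(_ rho); rewrite !inE.
    by case: (x.1 rho == _) => [->|].
  rewrite notwo => /eqP ->; apply: eq_card0 => rho.
  rewrite !inE xpair_eqE -!notwo; move/subsetP: sub12 => /(_ rho); rewrite !inE.
  by case: (x.1 rho == _) => [->|].
have : perm_eq (val2 (i, j)) (val2 (h, k)).
  apply/allP => c _; apply/eqP.
  by rewrite (count_val2 (i, j)) // (count_val2 (h, k)) //= card_h card_k.
case/tuple_permP => s def_ij; exists s.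
have eq_s rho : (i rho, j rho) = (h (s rho), k (s rho)).
  have := congr1 (fun x : seq _ => nth (one_, one_) x rho) def_ij.
  by rewrite -!tnth_nth !tnth_mktuple.
by apply/andP; split; apply/eqP/ffunP => rho; rewrite ffunE; case: (eq_s rho).
Qed.

End TwoSets.

(** * Binomial coefficients in characteristic p *)

Section BinomialChar.
Variables (K : fieldType) (p : nat).
Hypothesis charK : p \in [pchar K].

(** With [q = p ^ e], compare the coefficients at [X ^ q] in the identity
    [(1 + X) ^ N = (1 + X ^ q) ^ (N %/ q) * (1 + X) ^ (N %% q)] modulo [p]. *)
Lemma bin_pexp N e : ('C(N, p ^ e))%:R = (N %/ p ^ e)%:R :> K.
Proof.
have p_gt0 := prime_gt0 (pcharf_prime charK).
set q := (p ^ e)%N; have q_gt0 : (0 < q)%N by rewrite expn_gt0 p_gt0.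
have binE M k : ((1 + 'X) ^+ M : {poly K})`_k = ('C(M, k))%:R.
  rewrite exprDn coef_sum.
  under eq_bigr => i _ do rewrite expr1n mul1r coefMn coefXn.
  have [le_kM|lt_Mk] := leqP k M.
    rewrite (bigD1 (Ordinal (le_kM : k < M.+1)%N)) //= eqxx big1 ?addr0 // => i ne_i.
    by rewrite eq_sym (negbTE (ne_i : (i : nat) != k)) mul0rn.
  rewrite bin_small // big1 // => i _.
  by rewrite (_ : (k == i) = false) ?mul0rn //; have := ltn_ord i; lia.
have charP : p \in [pchar {poly K}] by rewrite pchar_poly.
have frob : (1 + 'X) ^+ q = 1 + 'X^q :> {poly K}.
  rewrite exprDn_pchar ?expr1n //.
  by rewrite pnatX pnatE ?charP ?(pcharf_prime charK).
(* Only the terms of degree at most [q] matter, hence the remainder [R]. *)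
have expand m : exists R : {poly K},
    (1 + 'X^q) ^+ m = 1 + m%:R *: 'X^q + 'X^q * ('X^q * R).
  elim: m => [|m [R IHm]]; first by exists 0; rewrite scale0r !mulr0 !addr0.
  exists (m%:R%:P + R + 'X^q * R).
  rewrite exprS IHm -!mul_polyC -natr1 rmorphD /=; ring.
rewrite -binE {1}(divn_eq N q) exprD mulnC exprM frob.
have [R ->] := expand (N %/ q)%N; rewrite !mulrDl mul1r !coefD.
rewrite -scalerAl -!mulrA coefZ !coefXnM ltnn subnn q_gt0 addr0.
by rewrite !binE bin0 mulr1 bin_small ?ltn_mod // add0r.
Qed.

Lemma bin_pexp_lt e e' : (e < e')%N -> ('C(p ^ e', p ^ e))%:R = 0 :> K.
Proof.
move=> lt_e; have p_gt0 := prime_gt0 (pcharf_prime charK).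
rewrite bin_pexp -expnB // ?(ltnW lt_e) //.
by apply/eqP; rewrite -(dvdn_pcharf charK) dvdn_exp // subn_gt0.
Qed.

End BinomialChar.

(** * Linear algebra *)

Section Infinite.
Variable K : fieldType.
Hypothesis Kinf : ~ cardinality.finite_set (@classical_sets.setT K).

Lemma poly_vanish_inf (q : {poly K}) : (forall z, z != 0 -> q.[z] = 0) -> q = 0.
Proof.
move=> q0; apply/eqP/negPn/negP => nz_q; apply: Kinf.
(* The factor ['X] makes 0 a root as well. *)
have nz_qX : q * 'X != 0 by rewrite mulf_neq0 // polyX_eq0.
pose P n := `[< exists2 s : seq K, uniq s & size s = n >].
have P0 : exists n, P n by exists 0%N; apply/asboolP; exists [::].
have Pmax n : P n -> leq n (size (q * 'X : {poly K})).
  move=> /asboolP[s s_uniq <-]; apply/ltnW/max_poly_roots => //.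
  apply/allP => z _; rewrite rootE hornerM hornerX.
  by have [->|/q0 ->] := eqVneq z 0; rewrite ?mulr0 ?mul0r.
case: (ex_maxnP P0 Pmax) => n /asboolP[s s_uniq def_n] maxn.
apply/cardinality.finite_seqP; exists s; apply/classical_sets.seteqP.
split=> z // _ /=; apply/negPn/negP => s'z.
have /maxn : P n.+1.
  by apply/asboolP; exists (z :: s); rewrite /= ?s'z // def_n.
by rewrite ltnn.
Qed.

(** A linear form that vanishes on [W], applied to the sums, gives a polynomial in
    [z] with infinitely many roots; its coefficients are the values of the form at
    the vectors in the conclusion. *)
Lemma powers_sum_mem (vT : vectType K) (W : {vspace vT}) (I : finType)
    (e : I -> nat) (v : I -> vT) :
    (forall z, z != 0 -> \sum_i z ^+ e i *: v i \in W) ->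
  forall n, \sum_(i | e i == n) v i \in W.
Proof.
move=> W_sum n; pose f : 'End(vT) := (\1 - projv W)%VF.
have memW x : (x \in W) = (f x == 0).
  rewrite !lfun_simp /= subr_eq0; apply/idP/eqP => [/projv_id -> // | ->].
  exact: memv_proj.
pose c k x := coord (vbasis {:vT}) k (f x).
rewrite memW (coord_vbasis (memvf (f _))) big1 // => k _.
pose q := \sum_i c k (v i) *: 'X^(e i).
have q0 : q = 0.
  apply: poly_vanish_inf => z /W_sum; rewrite memW => /eqP fz0.
  rewrite horner_sum -[RHS](linear0 (coord (vbasis {:vT}) k)) -fz0 !linear_sum.
  by apply: eq_bigr => i _; rewrite hornerZ hornerXn !linearZ /= mulrC.
suff -> : coord (vbasis {:vT}) k (f (\sum_(i | e i == n) v i)) = 0.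
  exact: scale0r.
rewrite !linear_sum -[RHS](coef0 K n) -q0 coef_sum big_mkcond.
apply: eq_bigr => i _.
by rewrite coefZ coefXn eq_sym; case: eqP; rewrite ?mulr1 ?mulr0.
Qed.

End Infinite.

Lemma free_family (K : fieldType) (vT : vectType K) (T : finType) (b : T -> vT) :
    (forall c : T -> K, \sum_t c t *: b t = 0 -> forall t, c t = 0) ->
  free [tuple b (enum_val k) | k < #|T|].
Proof.
move=> indep; apply/freeP => c sum0 k.
rewrite -(enum_valK k); apply: (indep (c \o enum_rank)).
rewrite -[RHS]sum0 (reindex _ (onW_bij _ (@enum_val_bij T))).
by apply: eq_bigr => i _; rewrite -tnth_nth tnth_mktuple /= enum_valK.
Qed.

(** * The basis of the Borel Schur algebra and its structure constants *)

Section BorelAlgebra.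
Variables (K : fieldType) (r : nat).
Notation tens := (tens K r).
Notation SB := (SB K r).

Definition ent (a : 'End(tens)) (h k : mindex r) : K := a (evec K k) h.

Lemma ent_sum (I : finType) (c : I -> K) (a : I -> 'End(tens)) h k :
  ent (\sum_i c i *: a i) h k = \sum_i c i * ent (a i) h k.
Proof.
rewrite /ent sum_lfunE sum_ffunE; apply: eq_bigr => i _.
by rewrite scale_lfunE ffunE.
Qed.

Lemma ent_scale c a h k : ent (c *: a) h k = c * ent a h k.
Proof. by rewrite /ent scale_lfunE ffunE. Qed.

Lemma entP (a b : 'End(tens)) : (forall h k, ent a h k = ent b h k) -> a = b.
Proof.
move=> eq_ab; apply/lfunP => v.
have -> : v = \sum_k v k *: evec K k.
  apply/ffunP => h; rewrite sum_ffunE (bigD1 h) //= !ffunE eqxx.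
  rewrite big1 ?addr0; first by rewrite [RHS]mulr1.
  by move=> k; rewrite !ffunE eq_sym => /negbTE ->; rewrite [LHS]mulr0.
rewrite !linear_sum; apply: eq_bigr => k _; rewrite !linearZ; congr (_ *: _).
by apply/ffunP => h; apply: eq_ab.
Qed.

Lemma ent_mx a h k : ent (mx_end a) h k = a h k.
Proof.
rewrite /ent mx_endE (bigD1 k) //= ffunE eqxx mulr1 big1 ?addr0 //.
by move=> m; rewrite ffunE => /negbTE ->; rewrite mulr0.
Qed.

Lemma ent_comp a b h k : ent (a \o b)%VF h k = \sum_m ent a h m * ent b m k.
Proof.
rewrite /ent comp_lfunE [in LHS](_ : b (evec K k) = \sum_m ent b m k *: evec K m).
  rewrite linear_sum sum_ffunE; apply: eq_bigr => m _.
  by rewrite linearZ ffunE mulrC.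
apply/ffunP => x; rewrite sum_ffunE (bigD1 x) //= !ffunE eqxx big1 ?addr0.
  by rewrite [RHS]mulr1.
by move=> m; rewrite !ffunE eq_sym => /negbTE ->; rewrite [LHS]mulr0.
Qed.

(** The basis element [xi i j] depends only on the numbers [t <= s] of 2's in
    [i <= j]; it is the divided power [e ^ (s - t) / (s - t)!] of the raising
    operator, restricted to the weight space spanned by the [e_k] with [s]
    entries equal to 2. *)
Definition E (t s : nat) : 'End(tens) := mx_end
  (fun h k => [&& ile h k, #|twos h| == t & #|twos k| == s]%:R).

Lemma ent_E t s h k :
  ent (E t s) h k = [&& ile h k, #|twos h| == t & #|twos k| == s]%:R.
Proof. exact: ent_mx. Qed.

Lemma xi_E i j : ile i j -> xi K i j = E #|twos i| #|twos j|.
Proof. by move=> le_ij; apply: entP => h k; rewrite ent_E ent_mx orb_eq_ile. Qed.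

Lemma E_out t s : ~~ (t <= s <= r)%N -> E t s = 0.
Proof.
move=> out; apply: entP => h k; rewrite ent_E /ent lfunE ffunE.
case: and3P => // -[]; rewrite ile_subset => /subset_leq_card + /eqP eq_t /eqP eq_s.
by rewrite eq_t eq_s => le_ts; case/negP: out; rewrite le_ts -eq_s card_twos_le.
Qed.

(** For [h <= k] with [t] and [u] entries 2, the multi-indices between them with
    [s] entries 2 correspond to the subsets of size [s - t] of the [u - t]
    positions where [h] and [k] differ. *)
Lemma E_comp t s u : (t <= s)%N ->
  (E t s \o E s u)%VF = ('C(u - t, s - t))%:R *: E t u.
Proof.
move=> le_ts; apply: entP => h k; rewrite ent_comp.
rewrite ent_scale ent_E.
under eq_bigr => m _ do rewrite !ent_E -natrM mulnb.
rewrite -natrM; transitivity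
  (#|[set m | [&& ile h m, #|twos h| == t & #|twos m| == s] &&
              [&& ile m k, #|twos m| == s & #|twos k| == u]]|%:R : K).
  rewrite -sum1dep_card natr_sum [RHS]big_mkcond.
  by apply: eq_bigr => m _; case: ifP.
congr (_%:R).
case: and3P => [[le_hk /eqP eq_t /eqP eq_u]|nhk]; last first.
  rewrite muln0; apply: eq_card0 => m; rewrite inE; apply/negP.
  move=> /andP[/and3P[le_hm eq_t _] /and3P[le_mk _ eq_u]]; case: nhk; split=> //.
  by move: le_hm le_mk; rewrite !ile_subset => /subset_trans; apply.
move: (le_hk); rewrite ile_subset => sub_hk.
rewrite muln1 -eq_u -[in RHS]eq_t -cardsDS // -cards_draws.
have dis (A : {set 'I_r}) : A \subset twos k :\: twos h ->
    (twos h :|: A) :\: twos h = A.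
  rewrite subsetD => /andP[_ dis_A].
  by rewrite setDUl setDv set0U; apply/setDidPl.
rewrite -(@card_in_imset _ _ (fun A : {set 'I_r} => of_twos (twos h :|: A))); last first.
  move=> A B; rewrite !inE => /andP[sA _] /andP[sB _] /(congr1 (@twos r)).
  by rewrite !of_twosK => eqAB; rewrite -(dis A) // -(dis B) // eqAB.
apply: eq_card => m; rewrite !inE !ile_subset eq_t eq_u !eqxx /= andbT.
apply/idP/imsetP => [/andP[/andP[sub_hm /eqP eq_s] /andP[sub_mk _]]|[A]].
  exists (twos m :\: twos h); last first.
    by rewrite -[X in X :|: _](setIidPr sub_hm) setID twosK.
  by rewrite inE setSD // cardsDS // eq_s eq_t eqxx.
rewrite inE => /andP[sA /eqP eqA] ->; rewrite !of_twosK subsetUl /=.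
rewrite subUset sub_hk (subset_trans sA (subsetDl _ _)) !andbT andbb.
move: (sA); rewrite subsetD => /andP[_ /disjoint_setI0 dis_A].
by rewrite cardsU setIC dis_A cards0 subn0 eq_t eqA subnKC.
Qed.

Lemma E_comp_ne t s s' u : s != s' -> (E t s \o E s' u)%VF = 0.
Proof.
move=> ne_s; apply: entP => h k; rewrite ent_comp {3}/ent lfunE ffunE big1 // => m _.
rewrite !ent_E; have [->|_] := eqVneq #|twos m| s.
  by rewrite (negbTE ne_s) andbF mulr0.
by rewrite !andbF mul0r.
Qed.

Lemma one_E : \1%VF = \sum_(s < r.+1) E s s.
Proof.
apply: entP => h k; rewrite {1}/ent lfunE /= ffunE.
under eq_bigr do rewrite -[E _ _]scale1r.
have lt_k : (#|twos k| < r.+1)%N := card_twos_le k.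
rewrite ent_sum (bigD1 (Ordinal lt_k)) //= ent_E eqxx andbT mul1r.
rewrite big1 ?addr0 => [|s ne_s]; last first.
  rewrite ent_E mul1r.
  have [eq_k|_] := eqVneq #|twos k| s; last by rewrite !andbF.
  by case/eqP: ne_s; apply/val_inj.
have [->|ne_hk] := eqVneq h k; first by rewrite eqxx andbT ile_subset subxx.
case: andP => // -[]; rewrite ile_subset => sub_hk /eqP eq_c.
case/eqP: ne_hk; apply: twos_inj; apply/eqP.
by rewrite eqEcard sub_hk eq_c leqnn.
Qed.

(** On the algebra, the coordinate at [E t s] is a matrix entry: [E t s] is the
    only basis element with a nonzero entry at [(std t, std s)]. *)
Definition coef (t s : nat) : 'Hom('End(tens), K^o) :=
  linfun (fun a => ent a (std r t) (std r s) : K^o).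

Lemma coefE t s a : coef t s a = ent a (std r t) (std r s).
Proof.
by rewrite linfunE // => c u v; rewrite /ent add_lfunE scale_lfunE !ffunE.
Qed.

Lemma coef_E t s t' s' : (t <= s <= r)%N ->
  coef t s (E t' s') = ((t == t') && (s == s'))%:R.
Proof.
move=> /andP[le_ts le_sr]; rewrite coefE ent_E std_ile // !card_std //.
exact: leq_trans le_sr.
Qed.

(** If [h <= k], the pairs of entries of [(h, k)] are [r - s] pairs (1,1),
    [s - t] pairs (1,2) and [t] pairs (2,2), with [t] and [s] the numbers of 2's
    in [h] and [k]. *)
Lemma tens_act_E g : is_trig_mx g^T -> tens_act r g =
  \sum_(x : 'I_r.+1 * 'I_r.+1)
    (g 0 0 ^+ (r - x.2) * g 0 1 ^+ (x.2 - x.1) * g 1 1 ^+ x.1) *: E x.1 x.2.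
Proof.
move=> /is_trig_mxP g_upper; have g10 : g 1 0 = 0.
  by have := g_upper 0 1 isT; rewrite mxE.
apply: entP => h k; rewrite ent_mx ent_sum.
have [x0 [x01 x02]] : exists x0 : 'I_r.+1 * 'I_r.+1,
    x0.1 = #|twos h| :> nat /\ x0.2 = #|twos k| :> nat.
  exists (inord #|twos h|, inord #|twos k|).
  by split; rewrite inordK // ltnS card_twos_le.
rewrite [RHS](bigD1 x0) //= [X in _ + X]big1 => [|x ne_x]; last first.
  rewrite ent_E; case: and3P => [[_ /eqP eq1 /eqP eq2]|]; last by rewrite mulr0.
  case/eqP: ne_x; apply/eqP.
  by rewrite -pair_eqE /pair_eq -!val_eqE /= !x01 !x02 eq1 eq2 !eqxx.
rewrite addr0 ent_E !x01 !x02 !eqxx !andbT.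
have [le_hk|] := boolP (ile h k); last first.
  rewrite negb_forall mulr0 => /existsP[rho lt_rho].
  rewrite (bigD1 rho) //= (_ : g _ _ = 0) ?mul0r //.
  move: lt_rho; rewrite -g10 => lt_rho; congr (g _ _); apply/val_inj.
    by case: (h rho) (k rho) lt_rho => [[|[|?]] ?] [[|[|?]] ?].
  by case: (h rho) (k rho) lt_rho => [[|[|?]] ?] [[|[|?]] ?].
rewrite mulr1; move: (le_hk); rewrite ile_subset => sub_hk.
have sum_mem (A : {set 'I_r}) : (\sum_rho (rho \in A) = #|A|)%N.
  by rewrite -sum1_card [RHS]big_mkcond; apply: eq_bigr => rho _; case: ifP.
have -> : (r - #|twos k|)%N = #|~: twos k| by rewrite [RHS]cardsCs setCK card_ord.
rewrite -(cardsDS sub_hk) -!sum_mem -!prodrXr -!big_split /=.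
apply: eq_bigr => rho _; move/forallP: le_hk => /(_ rho); rewrite !inE.
case: (h rho) (k rho) => [[|[|?]] ?] [[|[|?]] ?] //= _;
  rewrite ?mulr1 ?mul1r; congr (g _ _); exact/val_inj.
Qed.

Definition SB_expand : 'End('End(tens)) :=
  linfun (fun a => \sum_(x : 'I_r.+1 * 'I_r.+1) (coef x.1 x.2 a : K) *: E x.1 x.2).

Lemma SB_expandE a : SB_expand a =
  \sum_(x : 'I_r.+1 * 'I_r.+1) (coef x.1 x.2 a : K) *: E x.1 x.2.
Proof.
rewrite linfunE // => c u v; rewrite scaler_sumr -big_split /=.
by apply: eq_bigr => x _; rewrite linearP scalerDl scalerA.
Qed.

Lemma SB_expand_E t s : SB_expand (E t s) = E t s.
Proof.
have [/andP[le_ts le_sr]|out] := boolP (t <= s <= r)%N; last first.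
  by rewrite E_out // linear0.
have lt_s : (s < r.+1)%N by []; have lt_t : (t < r.+1)%N by apply: leq_trans lt_s.
rewrite SB_expandE (bigD1 (Ordinal lt_t, Ordinal lt_s)) //= coef_E ?le_ts //.
rewrite !eqxx scale1r big1 ?addr0 // => x ne_x.
have [le_x|out] := boolP (x.1 <= x.2 <= r)%N; last by rewrite (E_out out) scaler0.
rewrite coef_E //; case: andP => [[/eqP x1 /eqP x2]|]; last by rewrite scale0r.
by case/eqP: ne_x; case: x x1 x2 le_x => x1 x2 /= e1 e2 _; congr pair; apply/val_inj.
Qed.

Lemma SB_sum a : a \in SB ->
  a = \sum_(x : 'I_r.+1 * 'I_r.+1) (coef x.1 x.2 a : K) *: E x.1 x.2.
Proof.
rewrite -SB_expandE => /mem_span_pred[X tens_X Xa].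
rewrite (coord_span (Xa : a \in <<in_tuple X>>%VS)).
rewrite linear_sum; apply: eq_bigr => i _; rewrite linearZ; congr (_ *: _).
have [g /andP[_ g_upper] ->] := tens_X _ (mem_nth 0 (ltn_ord i)).
rewrite tens_act_E // linear_sum; apply: eq_bigr => x _.
by rewrite linearZ /= SB_expand_E.
Qed.

Hypothesis Kinf : ~ cardinality.finite_set (@classical_sets.setT K).

(** The curve [z |-> (1, z; 0, z ^ (r + 1))] in the Borel group separates the
    [E t s]: it acts as the sum of the [z ^ ((s - t) + (r + 1) * t) *: E t s],
    and the exponents are pairwise distinct. *)
Lemma mem_SB_E t s : E t s \in SB.
Proof.
have [/andP[le_ts le_sr]|out] := boolP (t <= s <= r)%N; last by rewrite E_out ?mem0v.
pose e (x : 'I_r.+1 * 'I_r.+1) := (x.1 * r.+1 + (x.2 - x.1))%N.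
have SBz z : z != 0 -> \sum_x z ^+ e x *: E x.1 x.2 \in SB.
  move=> nz_z; pose g : 'M[K]_2 := \matrix_(i, j)
    if i == 0 then if j == 0 then 1 else z else if j == 0 then 0 else z ^+ r.+1.
  have g_upper : is_trig_mx g^T.
    by apply/is_trig_mxP => -[[|[|?]] ?] [[|[|?]] ?] //= _; rewrite !mxE.
  have <- : tens_act r g = \sum_x z ^+ e x *: E x.1 x.2.
    rewrite tens_act_E //; apply: eq_bigr => x _; congr (_ *: _).
    by rewrite !mxE /= expr1n mul1r -exprM -exprD mulnC addnC.
  apply/mem_span_pred; exists [:: tens_act r g]; last by rewrite memv_span ?inE.
  move=> _ /[!inE] /eqP ->; exists g => //; rewrite /borel g_upper andbT.
  rewrite unitmxE unitfE -det_tr det_trig // !big_ord_recl big_ord0 !mxE /=.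
  by rewrite mul1r mulr1 expf_neq0.
have lt_s : (s < r.+1)%N by []; have lt_t : (t < r.+1)%N by apply: leq_trans lt_s.
pose x0 : 'I_r.+1 * 'I_r.+1 := (Ordinal lt_t, Ordinal lt_s).
have := powers_sum_mem Kinf SBz (e x0).
rewrite (bigD1 x0) //= big1 ?addr0 // => x /andP[/eqP eq_e ne_x].
apply: E_out; apply: contra ne_x => /andP[le_x _]; apply/eqP.
have lt_e (y : 'I_r.+1 * 'I_r.+1) : (y.2 - y.1 < r.+1)%N.
  exact: leq_ltn_trans (leq_subr _ _) (ltn_ord _).
have eq1 : x.1 = x0.1 :> nat.
  have := congr1 (divn^~ r.+1) eq_e.
  by rewrite /e !divnMDl // !divn_small ?lt_e // !addn0.
have eq2 : x.2 = x0.2 :> nat.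
  move: eq_e; rewrite /e eq1 => /addnI /=; move: le_x; rewrite eq1 /= => ? ?; lia.
by case: x eq1 eq2 {eq_e le_x} => x1 x2 /= e1 e2; congr pair; apply/val_inj.
Qed.

Lemma SB_ind (P : 'End(tens) -> Prop) :
    (forall c a b, P a -> P b -> P (c *: a + b)) -> (forall t s, P (E t s)) ->
  forall a, a \in SB -> P a.
Proof.
move=> PD PE a /SB_sum ->; elim/big_rec: _ => [|x b _ Pb]; last exact: PD.
by rewrite -(@E_out 1 0).
Qed.

Lemma SB_comp a b : a \in SB -> b \in SB -> (a \o b)%VF \in SB.
Proof.
move=> Sa Sb; elim/SB_ind: a / Sa => [c a a' Sa Sa'|t s].
  by rewrite comp_lfunDl -comp_lfunZl memvD ?memvZ.
elim/SB_ind: b / Sb => [c b b' Sb Sb'|s' u].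
  by rewrite comp_lfunDr -comp_lfunZr memvD ?memvZ.
have [<-|/E_comp_ne->] := eqVneq s s'; last exact: mem0v.
have [le_ts|lt_st] := leqP t s; last by rewrite E_out ?comp_lfun0l ?mem0v // leqNgt lt_st.
by rewrite E_comp // memvZ // mem_SB_E.
Qed.

Lemma SB_one : \1%VF \in SB.
Proof. by rewrite one_E memv_suml // => s _; apply: mem_SB_E. Qed.

Lemma SB_upper a h k : a \in SB -> ~~ ile h k -> ent a h k = 0.
Proof.
move=> /SB_sum -> /negbTE le_hk; rewrite ent_sum big1 // => x _.
by rewrite ent_E le_hk mulr0.
Qed.

(** Diagonal entries of upper triangular matrices multiply. *)
Lemma coef_comp n a b : a \in SB -> b \in SB ->
  coef n n (a \o b)%VF = (coef n n a : K) * (coef n n b : K) :> K.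
Proof.
move=> Sa Sb; rewrite !coefE ent_comp (bigD1 (std r n)) //= big1 ?addr0 // => m ne_m.
have [le1|nle] := boolP (ile (std r n) m); last by rewrite SB_upper ?mul0r.
have [le2|nle] := boolP (ile m (std r n)); last by rewrite [X in _ * X]SB_upper ?mulr0.
case/eqP: ne_m; apply: twos_inj; apply/eqP.
by rewrite eqEsubset -!ile_subset le1 le2.
Qed.

Lemma mem_SB_basis x :
  x \in SB_basis K r -> exists t s, (t <= s <= r)%N /\ x = E t s.
Proof.
rewrite mem_undup => /imageP[[i j]]; rewrite inE /= => le_ij ->.
exists #|twos i|, #|twos j|; rewrite xi_E // card_twos_le andbT.
by split=> //; rewrite subset_leq_card // -ile_subset.
Qed.

Lemma SB_basis_E t s : (t <= s <= r)%N -> E t s \in SB_basis K r.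
Proof.
move=> /andP[le_ts le_sr]; rewrite mem_undup; apply/imageP.
exists (std r t, std r s); rewrite ?inE /= ?std_ile // xi_E ?std_ile // !card_std //.
exact: leq_trans le_sr.
Qed.

Lemma Kla_charE la a : (la.1 <= r)%N -> a \in SB ->
  Kla_char la a = coef (r - la.1) (r - la.1) a :> K.
Proof.
move=> le_la Sa; set n := (r - la.1)%N.
have le_n : (n <= n <= r)%N by rewrite leqnn leq_subr.
have xilaE : xila K r la = E n n.
  by rewrite /xila xi_E ?card_twos_lidx // ile_subset.
have span_a : a \in <<in_tuple (SB_basis K r)>>%VS.
  rewrite [a]SB_sum // memv_suml // => x _; apply: memvZ.
  have [le_x|out] := boolP (x.1 <= x.2 <= r)%N; last by rewrite E_out ?mem0v.
  exact/memv_span/SB_basis_E.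
rewrite [in RHS](coord_span span_a) linear_sum; apply: eq_bigr => k _.
rewrite linearZ; congr (_ * _); rewrite xilaE.
have [t [s [le_ts def_k]]] := mem_SB_basis (mem_nth 0 (ltn_ord k)).
rewrite /= def_k coef_E //.
suff -> : (E t s == E n n) = (n == t) && (n == s) by [].
apply/eqP/andP => [eq_E|[/eqP <- /eqP <-] //].
have := coef_E n n le_n; rewrite -eq_E coef_E // !eqxx => /eqP.
by case: andP => [[/eqP <- /eqP <-]//|_]; rewrite eq_sym oner_eq0.
Qed.

End BorelAlgebra.

(** * Modules *)

Section ModuleLemmas.
Variables (K : fieldType) (V : vectType K) (A : {vspace 'End(V)}).

Lemma val_submod_act (M : actType V) (W : {vspace M}) a (u : subvs_of W) :
  is_submod A W -> a \in A -> vsval (act (submod W) a u) = act M a (vsval u).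
Proof.
move=> subW Aa; rewrite submodE vsprojK //.
exact: (subvP (subW a Aa)) (memv_img _ (subvsP u)).
Qed.

Lemma submod_lmod (M : actType V) (W : {vspace M}) :
  is_lmod A M -> is_submod A W -> is_lmod A (submod W).
Proof.
move=> [actD act1 actM] subW; split.
- move=> c a b Aa Ab; apply/lfunP => u; rewrite submodE actD // !lfun_simp.
  by rewrite !submodE linearP.
- by apply/lfunP => u; rewrite submodE act1 !lfunE /= vsvalK.
- move=> a b Aa Ab; apply/lfunP => u; apply: subvs_inj => /=.
  have memW x c : x \in W -> c \in A -> act M c x \in W.
    by move=> Wx /subW/subvP; apply; apply: memv_img.
  rewrite submodE actM // comp_lfunE [in RHS]comp_lfunE !val_submod_act //.
  by rewrite vsprojK // !memW ?subvsP.
Qed.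

Lemma dsum_lmod (M N : actType V) :
  is_lmod A M -> is_lmod A N -> is_lmod A (dsum_mod M N).
Proof.
move=> [MD M1 MM] [ND N1 NM]; split.
- move=> c a b Aa Ab; apply/lfunP => u; rewrite dsum_modE MD // ND //.
  by rewrite !lfun_simp !dsum_modE.
- by apply/lfunP => -[u v]; rewrite dsum_modE M1 N1 !lfunE.
- move=> a b Aa Ab; apply/lfunP => u.
  by rewrite dsum_modE MM // NM // !comp_lfunE !dsum_modE.
Qed.

Lemma dim1_indecomposable (M : actType V) :
  \dim {: M} = 1%N -> indecomposable A M.
Proof.
move=> dimM; split=> [fullv0|W1 W2 _ _ sumW capW].
  by move: dimM; rewrite fullv0 dimv0.
have dimW : (\dim W1 + \dim W2 = 1)%N.
  by rewrite -dimv_sum_cap sumW capW dimv0 addn0.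
have [W1_0|W1_gt] := posnP (\dim W1); first by left; apply/eqP; rewrite -dimv_eq0 W1_0.
by right; apply/eqP; rewrite -dimv_eq0; lia.
Qed.

End ModuleLemmas.

(** * The right module P1 and its dual in coordinates *)

Section ProjectiveModule.
Variables (K : fieldType) (p r d : nat) (la : nat * nat).
Hypothesis Kinf : ~ cardinality.finite_set (@classical_sets.setT K).
Hypothesis charK : p \in [pchar K].
Hypothesis la_r : (la.1 + la.2)%N = r.
Hypothesis d_la : (p ^ d <= la.2 < p ^ d.+1)%N.

Notation SB := (SB K r).
Notation E := (E K r).
Notation coef := (coef K r).
Notation n := (la.2).
Notation P1 := (P1 K r p d la).
Notation P1_ract := (P1_ract p d la).
Notation p1t := (p1t p d la).
Notation DP1 := (DP1 K r p d la).
Implicit Types (e : 'I_d.+1) (s t : nat).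

(** The second part of [la(1, p ^ e)]. *)
Definition wt e := (n - p ^ e)%N.

Lemma p_gt0 : (0 < p)%N.
Proof. exact/prime_gt0/(pcharf_prime charK). Qed.

Lemma pe_gt0 e : (0 < p ^ e)%N.
Proof. by rewrite expn_gt0 p_gt0. Qed.

Lemma pe_le e : (p ^ e <= n)%N.
Proof.
case/andP: d_la => le_pd _; apply: leq_trans le_pd.
by rewrite leq_pexp2l ?p_gt0 // -ltnS ltn_ord.
Qed.

Lemma wt_lt e : (wt e < n)%N.
Proof. by have := pe_gt0 e; have := pe_le e; rewrite /wt; lia. Qed.

Lemma wtK e : (n - wt e)%N = (p ^ e)%N.
Proof. by rewrite subKn ?pe_le. Qed.

Lemma wt_lt_wt e e' : (e < e')%N -> (wt e' < wt e)%N.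
Proof.
move=> lt_e; have := pe_le e'; rewrite /wt.
have : (p ^ e < p ^ e')%N by rewrite ltn_exp2l // prime_gt1 // (pcharf_prime charK).
lia.
Qed.

Lemma n_le_r : (n <= r)%N. Proof. by rewrite -la_r leq_addl. Qed.

Lemma la1_le_r : (la.1 <= r)%N. Proof. by rewrite -la_r leq_addr. Qed.

Lemma rBla1 : (r - la.1)%N = n. Proof. by rewrite -la_r addKn. Qed.

Lemma rBla1e e : (r - (la1 la (p ^ e)).1)%N = wt e.
Proof. by rewrite /la1 /= subnDA rBla1. Qed.

Lemma la1e_le_r e : ((la1 la (p ^ e)).1 <= r)%N.
Proof. by have := pe_le e; rewrite /la1 /=; have := la_r; lia. Qed.

Lemma lidx_la : lidx r la = std r n.
Proof. by rewrite lidx_std ?la1_le_r // rBla1. Qed.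

Lemma lidx_la1 e : lidx r (la1 la (p ^ e)) = std r (wt e).
Proof. by rewrite lidx_std ?la1e_le_r // rBla1e. Qed.

Lemma xi_std t s : (t <= s <= r)%N -> xi K (std r t) (std r s) = E t s.
Proof.
move=> /andP[le_ts le_sr]; rewrite xi_E ?std_ile // !card_std //.
exact: leq_trans le_sr.
Qed.

Lemma wt_le_r e : (wt e <= r)%N.
Proof. exact: leq_trans (ltnW (wt_lt e)) n_le_r. Qed.

Lemma xila_wt e : xila K r (la1 la (p ^ e)) = E (wt e) (wt e).
Proof. by rewrite /xila lidx_la1 xi_std // leqnn wt_le_r. Qed.

Lemma xi_wt e : xi K (lidx r (la1 la (p ^ e))) (lidx r la) = E (wt e) n.
Proof. by rewrite lidx_la1 lidx_la xi_std // (ltnW (wt_lt e)) n_le_r. Qed.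

Lemma E_idl t s : (E t t \o E t s)%VF = E t s.
Proof. by rewrite E_comp // subnn bin0 scale1r. Qed.

Lemma E_idr t s : (E t s \o E s s)%VF = E t s.
Proof.
have [le_ts|lt_st] := leqP t s; first by rewrite E_comp // binn scale1r.
by rewrite E_out ?comp_lfun0l // leqNgt lt_st.
Qed.

Lemma mem_rideal (x a : 'End(tens K r)) :
  a \in rideal x <-> exists2 b, b \in SB & a = (x \o b)%VF.
Proof.
split=> [/memv_imgP[b Sb ->]|[b Sb ->]]; first by exists b; rewrite ?lcompE.
by rewrite -lcompE memv_img.
Qed.

Lemma mem_P1 x : x \in P1 <->
  forall e, x e \in SB /\ (E (wt e) (wt e) \o x e)%VF = x e.
Proof.
rewrite mem_dsum_vspace; split=> [/forallP Px e|Px].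
  have /mem_rideal[b Sb ->] := Px e; rewrite xila_wt.
  by rewrite comp_lfunA E_idl SB_comp // mem_SB_E.
apply/forallP => e; apply/mem_rideal; have [Sx def_x] := Px e.
by exists (x e); rewrite ?xila_wt.
Qed.

Lemma P1_SB (v : subvs_of P1) e : vsval v e \in SB.
Proof. by have /mem_P1/(_ e)[] := subvsP v. Qed.

Lemma val_ract a (v : subvs_of P1) : a \in SB ->
  vsval (P1_ract a v) = [ffun e => (vsval v e \o a)%VF].
Proof.
move=> Sa; rewrite P1_ractE vsprojK //; apply/mem_P1 => e; rewrite ffunE.
have /mem_P1/(_ e)[Sv def_v] := subvsP v.
by rewrite SB_comp // comp_lfunA def_v.
Qed.

Lemma val_p1t a : a \in SB -> vsval (p1t a) = [ffun e => (E (wt e) n \o a)%VF].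
Proof.
move=> Sa; rewrite vsprojK; first by apply/ffunP => e; rewrite !ffunE xi_wt.
apply/mem_P1 => e; rewrite ffunE xi_wt comp_lfunA E_idl.
by rewrite SB_comp // mem_SB_E.
Qed.

Lemma ract_p1t a b : a \in SB -> b \in SB -> P1_ract a (p1t b) = p1t (b \o a)%VF.
Proof.
move=> Sa Sb; apply: subvs_inj; rewrite val_ract // !val_p1t ?SB_comp //.
by apply/ffunP => e; rewrite !ffunE comp_lfunA.
Qed.

Lemma DP1_lmod : is_lmod SB DP1.
Proof.
split=> /=.
- move=> c a b Sa Sb; apply/lfunP => psi; rewrite !lfun_simp !rcompE.
  apply/lfunP => v; rewrite !lfun_simp /= -linearP; congr (psi _).
  apply: subvs_inj; rewrite [RHS]linearP. 
  rewrite !val_ract // ?memvD ?memvZ //.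
  by apply/ffunP => e; rewrite !ffunE comp_lfunDr -comp_lfunZr /= !val_ract // !ffunE.
- apply/lfunP => psi; rewrite rcompE lfunE /=.
  apply/lfunP => v; rewrite comp_lfunE; congr (psi _); apply: subvs_inj.
  by rewrite val_ract ?SB_one //; apply/ffunP => e; rewrite !ffunE comp_lfun1r.
- move=> a b Sa Sb; apply/lfunP => psi; rewrite comp_lfunE !rcompE.
  apply/lfunP => v; rewrite !comp_lfunE; congr (psi _); apply: subvs_inj.
  rewrite !val_ract ?SB_comp //; apply/ffunP => e.
  by rewrite !ffunE comp_lfunA.
Qed.

Lemma act_DP1 a (psi : DP1) v : act DP1 a psi v = psi (P1_ract a v).
Proof. by rewrite /= rcompE comp_lfunE. Qed.

Lemma KlaE a : a \in SB -> Kla_char la a = coef n n a :> K.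
Proof. by move=> Sa; rewrite Kla_charE ?la1_le_r // rBla1. Qed.

Lemma act_Kla a (c : Kla K r la) : a \in SB ->
  act (Kla K r la) a c = (coef n n a : K) * (c : K) :> K.
Proof. by move=> Sa; rewrite /= !lfun_simp KlaE. Qed.

Lemma coef_one : coef n n \1%VF = 1 :> K.
Proof. by rewrite coefE /ent lfunE ffunE eqxx. Qed.

Lemma Kla_lmod : is_lmod SB (Kla K r la).
Proof.
split.
- move=> c a b Sa Sb; apply/lfunP => x.
  rewrite [RHS]add_lfunE [in RHS]scale_lfunE !act_Kla ?memvD ?memvZ // linearP mulrDl.
  by rewrite -mulrA.
- by apply/lfunP => x; rewrite act_Kla ?SB_one // coef_one mul1r lfunE.
- move=> a b Sa Sb; apply/lfunP => x; rewrite comp_lfunE !act_Kla ?SB_comp //.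
  by rewrite coef_comp // mulrA.
Qed.

(** The elements [G e s] with [wt e <= s <= r] form the basis of [P1] given by the
    basis of the algebra; for the other [s], [G e s] is zero. *)
Definition G e s : subvs_of P1 := vsproj P1 (ffun_inj e (E (wt e) s)).

Lemma val_G e s : vsval (G e s) = ffun_inj e (E (wt e) s).
Proof.
rewrite vsprojK //; apply/mem_P1 => e'; rewrite ffunE.
case: eqP => [->|_]; last by rewrite comp_lfun0r mem0v.
by rewrite mem_SB_E // E_idl.
Qed.

Lemma G_out e s : ~~ (wt e <= s <= r)%N -> G e s = 0.
Proof.
move=> out; apply: subvs_inj; rewrite val_G E_out //.
by apply/ffunP => e'; rewrite !ffunE if_same.
Qed.

Lemma ract_G e s t u : P1_ract (E t u) (G e s) =
  if (s == t) && (wt e <= t)%N then ('C(u - wt e, t - wt e))%:R *: G e u else 0.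
Proof.
have [->|ne_st] := eqVneq s t; last first.
  apply: subvs_inj; rewrite val_ract ?mem_SB_E // val_G.
  apply/ffunP => e'; rewrite !ffunE.
  by case: eqP => _; rewrite ?comp_lfun0l // E_comp_ne.
have [le_t|lt_t] := leqP (wt e) t; last first.
  by rewrite G_out ?linear0 // leqNgt lt_t.
apply: subvs_inj; rewrite val_ract ?mem_SB_E // val_G.
rewrite linearZ /= val_G; apply/ffunP => e'; rewrite !ffunE.
by case: eqP => _; rewrite ?comp_lfun0l ?scaler0 // E_comp.
Qed.

(** The coordinate of [p1t (E n s)] at [G e s]. *)
Definition p1_coef e s : K := ('C(s - n + p ^ e, p ^ e))%:R.

Lemma p1t_E s : (n <= s)%N -> p1t (E n s) = \sum_e p1_coef e s *: G e s.
Proof.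
move=> le_ns; apply: subvs_inj; rewrite val_p1t ?mem_SB_E // linear_sum.
apply/ffunP => e; rewrite sum_ffunE !ffunE (bigD1 e) //= big1 ?addr0.
  rewrite val_G !ffunE eqxx E_comp ?(ltnW (wt_lt e)) // wtK.
  rewrite (_ : s - wt e = s - n + p ^ e)%N //.
  by have := pe_le e; rewrite /wt; lia.
by move=> e' ne_e; rewrite val_G !ffunE eq_sym (negbTE ne_e) scaler0.
Qed.

Lemma DP1_eq0 (phi : DP1) : (forall e s, phi (G e s) = 0) -> phi = 0.
Proof.
move=> phiG.
have injD e c a b : ffun_inj e (c *: a + b) =
    c *: ffun_inj e a + ffun_inj e b :> {ffun 'I_d.+1 -> 'End(tens K r)}.
  by apply/ffunP => e'; rewrite !ffunE; case: eqP; rewrite ?scaler0 ?addr0.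
have phi0 e a : a \in SB ->
    phi (vsproj P1 (ffun_inj e (E (wt e) (wt e) \o a)%VF)) = 0.
  move=> Sa; elim/SB_ind: a / Sa => [c a b phia phib|t s].
    rewrite comp_lfunDr -comp_lfunZr injD linearP /= linearP /=.
    by rewrite phia phib scaler0 addr0.
  have [<-|ne_t] := eqVneq (wt e) t; first by rewrite E_idl; apply: phiG.
  rewrite E_comp_ne // (_ : ffun_inj e 0 = 0) ?linear0 //.
  by apply/ffunP => e'; rewrite !ffunE if_same.
apply/lfunP => v; rewrite [RHS]lfunE /=.
have -> : v = \sum_e vsproj P1 (ffun_inj e (vsval v e)).
  rewrite -linear_sum -[LHS]vsvalK; congr vsproj; apply/ffunP => e.
  rewrite sum_ffunE (bigD1 e) //= ffunE eqxx big1 ?addr0 // => e' ne_e.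
  by rewrite ffunE eq_sym (negbTE ne_e).
rewrite linear_sum big1 // => e _; have /mem_P1/(_ e)[Sv <-] := subvsP v.
exact: phi0.
Qed.

Lemma DP1_ext (psi psi' : DP1) :
  (forall e s, psi (G e s) = psi' (G e s)) -> psi = psi'.
Proof.
move=> eq_psi; apply/eqP; rewrite -subr_eq0; apply/eqP/DP1_eq0 => e s.
by rewrite !lfun_simp eq_psi subrr.
Qed.

Definition Gdual e s : DP1 :=
  linfun (fun v : subvs_of P1 => coef (wt e) s (vsval v e)).

Lemma GdualE e s v : Gdual e s v = coef (wt e) s (vsval v e).
Proof. by rewrite linfunE // => c u u'; rewrite linearP !ffunE linearP. Qed.

Lemma Gdual_G e s e' s' : (wt e <= s <= r)%N ->
  Gdual e s (G e' s') = ((e == e') && (s == s'))%:R.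
Proof.
move=> le_s; rewrite GdualE val_G ffunE.
case: eqP le_s => [->|_] le_s; last exact: linear0.
rewrite coef_E //. 
by rewrite eqxx.
Qed.


(** * The basis B2 and the submodules that it defines *)

Lemma p1_coef_eq0 e s : (p1_coef e s == 0) = (digit p (s - n) e == p.-1).
Proof.
rewrite /p1_coef bin_pexp // divnDr // divnn pe_gt0 // addn1.
rewrite -(dvdn_pcharf charK) /digit.
set q := ((s - n) %/ p ^ e)%N; have p_pos := p_gt0.
have lt_q : (q %% p < p)%N by rewrite ltn_mod.
rewrite {1}(divn_eq q p) -addnS dvdn_addr ?dvdn_mull //.
apply/idP/eqP => [|->]; last by rewrite prednK.
by case/dvdnP => -[|[|k]]; lia.
Qed.

Notation Jhat := (Jhat r p d la).
Notation Jhat_at := (Jhat_at r p d la).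
Notation B2 := (@B2 K r p d la).
Implicit Types (j : mindex r).

Lemma mem_Jla j :
  (j \in Jset r la) = (j == std r #|twos j|) && (n <= #|twos j|)%N.
Proof. by rewrite mem_Jset ?la1_le_r // rBla1. Qed.

(** The digit [a_e] of [a(j)] is [p - 1] exactly when the coordinate of
    [p1t (xi_{l,j})] in the [e]-th summand vanishes, so that the set [Jhat]
    consists of the [j] in [J] with [p1t (xi_{l,j})] nonzero, and [m(j)] is the first
    summand where it has a nonzero coordinate. *)
Lemma mem_Jhat j : (j \in Jhat) =
  [&& j == std r #|twos j|, (n <= #|twos j|)%N
    & [exists e : 'I_d.+1, p1_coef e #|twos j| != 0]].
Proof.
rewrite inE mem_Jla -andbA.
have [def_j|//] := eqVneq j (std r #|twos j|); have [le_n|//] := leqP n #|twos j|.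
rewrite /= {1}def_j atwo_std ?la1_le_r ?rBla1 ?le_n ?card_twos_le //.
by apply: eq_existsb => e; rewrite p1_coef_eq0.
Qed.

Lemma Jhat_atP j : j \in Jhat ->
  exists2 e : 'I_d.+1, j \in Jhat_at e & p1_coef e #|twos j| != 0.
Proof.
move=> Jj; move: (Jj); rewrite mem_Jhat => /and3P[/eqP def_j le_n /existsP[e0 nz_e0]].
have def_a : atwo la j = (#|twos j| - n)%N.
  by rewrite {1}def_j atwo_std ?la1_le_r ?rBla1 ?le_n ?card_twos_le.
set a := (fun t => digit p (atwo la j) t < p.-1)%N.
have has_a : has a (iota 0 d.+1).
  apply/hasP; exists (e0 : nat); first by rewrite mem_iota /= ltn_ord.
  rewrite /a ltn_neqAle def_a -p1_coef_eq0 nz_e0 /= -ltnS prednK ?p_gt0 //.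
  by rewrite ltn_mod p_gt0.
have lt_m : (mmin p d la j < d.+1)%N by rewrite -[X in (_ < X)%N](size_iota 0) -has_find.
exists (Ordinal lt_m); first by rewrite inE Jj /=.
have := nth_find 0%N has_a; rewrite nth_iota //.
by rewrite p1_coef_eq0 -def_a => /ltn_eqF ->.
Qed.

Lemma Jhat_at_uniq j e e' : j \in Jhat_at e -> j \in Jhat_at e' -> e = e'.
Proof. by rewrite !inE => /andP[_ /eqP ->] /andP[_ /eqP]/val_inj. Qed.

Lemma B2_leftE (x : B2_left r p d la) :
  [/\ (val x).2 = std r #|twos (val x).2|, (wt (val x).1 <= #|twos (val x).2|)%N,
      (val x).2 \notin Jhat_at (val x).1
    & B2 (inl x) = G (val x).1 #|twos (val x).2|].
Proof.
case: x => -[e j] /= Jx; move: (Jx); rewrite inE => /andP[J'j].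
rewrite mem_Jset ?la1e_le_r // rBla1e // => /andP[/eqP def_j le_j].
split=> //; rewrite /G lidx_la1 // {1}def_j xi_std //.
by rewrite le_j card_twos_le.
Qed.

Lemma B2_rightE (x : B2_right r p d la) : B2 (inr x) = p1t (E n #|twos (val x)|).
Proof.
case: x => j /= Jj; move: (Jj); rewrite mem_Jhat => /and3P[/eqP def_j le_n _].
by rewrite lidx_la {1}def_j xi_std // le_n card_twos_le.
Qed.

Lemma Gdual_p1t e s s' : (wt e <= s <= r)%N -> (n <= s')%N ->
  Gdual e s (p1t (E n s')) = if s == s' then p1_coef e s else 0.
Proof.
move=> le_s le_n; rewrite p1t_E // linear_sum (bigD1 e) //= big1 => [|e' ne_e].
  rewrite addr0 linearZ /= Gdual_G // eqxx /=.
  by case: eqP => [->|_]; [exact: mulr1 | exact: mulr0].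
by rewrite linearZ /= Gdual_G // eq_sym (negbTE ne_e); exact: mulr0.
Qed.

(** Triangularity of [B2] with respect to [G]: the coordinate at [(m(j), j)]
    sees, among the elements of [B2], only [p1t (xi_{l,j})]. *)
Lemma B2_free :
  free [tuple B2 (enum_val k) | k < #|{: B2_left r p d la + B2_right r p d la}|].
Proof.
apply: free_family => c; rewrite big_sumType /= => sum0.
have c_right (x : B2_right r p d la) : c (inr x) = 0.
  have [e Je nz_e] := Jhat_atP (valP x).
  move: (valP x); rewrite mem_Jhat => /and3P[/eqP def_x le_n _].
  have le_x : (wt e <= #|twos (val x)| <= r)%N.
    by rewrite (leq_trans (ltnW (wt_lt e))) // card_twos_le.
  have := congr1 (Gdual e #|twos (val x)|) sum0.
  rewrite linear0 linearD !linear_sum /= big1 => [|y _].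
    rewrite add0r (bigD1 x) //= big1 => [|y ne_y].
      rewrite addr0 linearZ /= -/(B2 (inr x)) B2_rightE Gdual_p1t // eqxx.
      by move/eqP; rewrite mulf_eq0 (negbTE nz_e) orbF => /eqP.
    move: (valP y); rewrite mem_Jhat => /and3P[/eqP def_y le_n' _].
    rewrite linearZ /= -/(B2 (inr y)) B2_rightE Gdual_p1t //.
    case: eqP => [eq_xy|_]; last exact: mulr0.
    by case/eqP: ne_y; apply: val_inj; rewrite def_x def_y eq_xy.
  have [def_y le_y J'y B2y] := B2_leftE y.
  rewrite linearZ /= -/(B2 (inl y)) B2y Gdual_G //.
  case: andP => [[/eqP eq_e /eqP eq_s]|_]; last exact: mulr0.
  by case/negP: J'y; rewrite def_y -eq_s -eq_e -def_x.
case=> x; last exact: c_right.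
move: sum0; rewrite [X in _ + X]big1 => [|y _]; last by rewrite c_right scale0r.
rewrite addr0 => sum0; have [def_x le_x _ B2x] := B2_leftE x.
have le_x' : (wt (val x).1 <= #|twos (val x).2| <= r)%N by rewrite le_x card_twos_le.
have := congr1 (Gdual (val x).1 #|twos (val x).2|) sum0.
rewrite linear0 linear_sum (bigD1 x) //= big1 => [|y ne_y].
  rewrite addr0 linearZ /= -/(B2 (inl x)) B2x Gdual_G // !eqxx /=.
  by move/eqP; rewrite mulf_eq0 oner_eq0 orbF => /eqP.
have [def_y le_y _ B2y] := B2_leftE y.
rewrite linearZ /= -/(B2 (inl y)) B2y Gdual_G //.
case: andP => [[/eqP eq_e /eqP eq_s]|_]; last exact: mulr0.
case/eqP: ne_y; apply: val_inj.
rewrite [val y]surjective_pairing [val x]surjective_pairing.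
by rewrite eq_e def_x def_y eq_s.
Qed.

Definition right_index j (Jj : j \in Jhat) : B2_right r p d la := exist _ j Jj.

Lemma p1t_Jhat s (Js : std r s \in Jhat) : (s <= r)%N ->
  p1t (E n s) = B2 (inr (right_index Js)).
Proof. by move=> le_r; rewrite B2_rightE /= card_std. Qed.

Lemma p1t_notJhat s : (n <= s <= r)%N -> std r s \notin Jhat -> p1t (E n s) = 0.
Proof.
move=> /andP[le_n le_r] J's.
rewrite p1t_E // big1 // => e _; apply/eqP; rewrite scaler_eq0; apply/orP; left.
apply: contraR J's => nz_e; rewrite mem_Jhat card_std // eqxx le_n /=.
by apply/existsP; exists e.
Qed.

(** [B2] spans: it contains [G e s] unless [std s] lies in the [e]-th part of
    [Jhat], and in this case [G e s] is recovered from [p1t (E n s)], whose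
    coordinate at [G e s] is nonzero and whose other terms lie in [B2]. *)
Lemma B2_total (psi : DP1) : (forall x, psi (B2 x) = 0) -> psi = 0.
Proof.
move=> psi0; apply: DP1_eq0 => // e s.
have [le_s|out] := boolP (wt e <= s <= r)%N; last by rewrite G_out // linear0.
case/andP: (le_s) => le_e le_r.
have psiG e' : (wt e' <= s)%N -> std r s \notin Jhat_at e' -> psi (G e' s) = 0.
  move=> le_e' J's; have Px : (e', std r s).2 \in
      Jset r (la1 la (p ^ (e', std r s).1)) :\: Jhat_at (e', std r s).1.
    by rewrite inE J's std_in_Jset ?la1e_le_r // rBla1e.
  pose x : B2_left r p d la := exist _ (e', std r s) Px.
  have := psi0 (inl x); have [_ _ _ ->] := B2_leftE x.
  by rewrite /= card_std.
have [Js|] := boolP (std r s \in Jhat_at e); last exact: psiG.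
have Js' : std r s \in Jhat by move: Js; rewrite inE => /andP[].
have [e1 Je1] := Jhat_atP Js'; rewrite -(Jhat_at_uniq Js Je1) card_std // => nz_e.
have le_n : (n <= s)%N by move: Js'; rewrite mem_Jhat card_std // => /and3P[].
have := psi0 (inr (right_index Js')); rewrite B2_rightE /= card_std // p1t_E //.
rewrite linear_sum (bigD1 e) //= big1 => [|e' ne_e].
  rewrite addr0 linearZ => /eqP; rewrite scaler_eq0 (negbTE nz_e) => /eqP //.
rewrite linearZ /= psiG; first exact: mulr0.
  exact: leq_trans (ltnW (wt_lt e')) le_n.
by apply: contra ne_e => Je'; apply/eqP/(Jhat_at_uniq Je' Js).
Qed.

Notation Uspace := (Uspace K r p d la).
Notation Espace := (Espace K r p d la).

(** The dual vectors that span [Uspace] are those vanishing on the [p1t (xi_{l,j})]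
    with [j] in [Jhat]; for the other [j] these elements are zero. *)
Lemma mem_U (psi : DP1) : psi \in Uspace <->
  forall s, (n <= s <= r)%N -> psi (p1t (E n s)) = 0.
Proof.
split=> [Upsi s le_s | psi0].
  case/andP: (le_s) => _ le_r.
  have [Js|/(p1t_notJhat le_s) ->] := boolP (std r s \in Jhat); last exact: linear0.
  rewrite (p1t_Jhat Js le_r).
  move: Upsi; rewrite /Uspace; set X := [seq _ | x : _]; move=> Upsi.
  rewrite (coord_span (Upsi : psi \in <<in_tuple X>>%VS)) sum_lfunE big1 // => i _.
  rewrite scale_lfunE; have /imageP[x _ ->] := mem_nth 0 (ltn_ord i).
  by rewrite dual_vecE ?B2_free // scaler0.
have -> : psi = \sum_x psi (B2 x) *: dual_vec B2 x.
  apply/eqP; rewrite -subr_eq0; apply/eqP/B2_total => x.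
  rewrite add_lfunE opp_lfunE sum_lfunE (bigD1 x) //= big1 => [|x' ne_x].
    by rewrite scale_lfunE dual_vecE ?B2_free // eqxx addr0 [_ *: _]mulr1 subrr.
  by rewrite scale_lfunE dual_vecE ?B2_free // (negbTE ne_x) scaler0.
rewrite memv_suml // => -[x|x] _.
  by apply/memvZ/memv_span/imageP; exists x.
rewrite B2_rightE psi0 ?scale0r ?mem0v //; move: (valP x).
by rewrite mem_Jhat card_twos_le => /and3P[_ ->].
Qed.

Lemma zvec_p1t s : (n <= s <= r)%N ->
  zvec K p d la (lidx r la) (p1t (E n s)) = (s == n)%:R.
Proof.
move=> le_s.
have Jn : lidx r la \in Jhat.
  rewrite lidx_la mem_Jhat card_std ?n_le_r // eqxx leqnn /=.
  apply/existsP; exists ord0; rewrite p1_coef_eq0 subnn /digit div0n mod0n.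
  by have := prime_gt1 (pcharf_prime charK); lia.
case/andP: (le_s) => _ le_r.
rewrite /zvec insubT /=; have [Js|J's] := boolP (std r s \in Jhat).
  rewrite (p1t_Jhat Js le_r) dual_vecE ?B2_free //; congr (nat_of_bool _)%:R.
  rewrite -[LHS]/(lidx r la == std r s) lidx_la.
  apply/eqP/eqP => [/(congr1 (fun j => #|twos j|))|-> //].
  by rewrite !card_std ?n_le_r.
rewrite (p1t_notJhat le_s J's) linear0; case: eqP => // eq_s; case/negP: J's.
by rewrite eq_s -lidx_la.
Qed.

Lemma p1t_lin c (a b : 'End(tens K r)) :
  p1t (c *: a + b) = c *: p1t a + p1t b.
Proof.
rewrite /p1t -linearP; congr vsproj; apply/ffunP => e.
by rewrite !ffunE comp_lfunDr -comp_lfunZr.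
Qed.

Lemma p1t0 : p1t (0 : 'End(tens K r)) = 0.
Proof.
have := p1t_lin 1 0 0; rewrite !scale1r addr0 -[X in X = _]addr0.
by move/addrI/esym.
Qed.

(** Conditions on the [p1t (E n s)] are traded for conditions on
    the whole right ideal of [E n n], which are visibly stable under the algebra. *)
Lemma p1t_values (psi : DP1) (c : K) :
  (forall s, (n <= s <= r)%N -> psi (p1t (E n s)) = (s == n)%:R * c) <->
  (forall a, a \in SB -> psi (p1t (E n n \o a)%VF) = (coef n n a : K) * c).
Proof.
have le_n : (n <= n <= r)%N by rewrite leqnn n_le_r.
split=> psi_E => [a Sa|s le_s]; last first.
  by rewrite -E_idl psi_E ?mem_SB_E // coef_E // eqxx eq_sym.
elim/SB_ind: a / Sa => [b a a' psi_a psi_a'|t s].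
  rewrite comp_lfunDr -comp_lfunZr p1t_lin linearP [coef n n _]linearP /=.
  by rewrite psi_a psi_a' mulrDl -[in RHS]mulrA.
have [<-|ne_nt] := eqVneq n t; last first.
  by rewrite E_comp_ne // p1t0 linear0 coef_E // (negbTE ne_nt) mul0r.
rewrite E_idl; have [le_s|out] := boolP (n <= s <= r)%N.
  by rewrite psi_E // coef_E // eqxx eq_sym.
by rewrite E_out // p1t0 !linear0 mul0r.
Qed.

Lemma mem_UP (psi : DP1) : psi \in Uspace <->
  forall a, a \in SB -> psi (p1t (E n n \o a)%VF) = 0.
Proof.
have := p1t_values psi 0; rewrite mem_U => valP; split=> psi0.
  by move=> a Sa; rewrite (valP.1 _ a Sa) ?mulr0 // => s /psi0 ->; rewrite mulr0.
by move=> s le_s; rewrite (valP.2 _ s le_s) ?mulr0 // => a /psi0 ->; rewrite mulr0.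
Qed.

Lemma mem_EP (x : DPK K r p d la) : x \in Espace <->
  forall a, a \in SB ->
    (x.1 : DP1) (p1t (E n n \o a)%VF) = (coef n n a : K) * (x.2 : K).
Proof.
rewrite mem_Espace mem_U -p1t_values; set z := zvec _ _ _ _ _.
have zE s : (n <= s <= r)%N -> (x.1 - (x.2 : K) *: z : DP1) (p1t (E n s)) =
    (x.1 : DP1) (p1t (E n s)) - (s == n)%:R * (x.2 : K).
  by move=> le_s; rewrite add_lfunE opp_lfunE scale_lfunE zvec_p1t // [_ *: _]mulrC.
split=> x_E s le_s.
  by apply/eqP; rewrite -subr_eq0 -zE // x_E.
by rewrite zE // x_E // subrr.
Qed.

Lemma act_DP1_p1t a b (psi : DP1) : a \in SB -> b \in SB ->
  act DP1 a psi (p1t (E n n \o b)%VF) = psi (p1t (E n n \o (b \o a))%VF).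
Proof.
by move=> Sa Sb; rewrite act_DP1 ract_p1t ?comp_lfunA // SB_comp // mem_SB_E.
Qed.

Lemma U_submod : is_submod SB Uspace.
Proof.
move=> a Sa; apply/subvP => _ /memv_imgP[psi /mem_UP psi0 ->]; apply/mem_UP => b Sb.
by rewrite act_DP1_p1t // psi0 // SB_comp.
Qed.

Lemma E_submod : is_submod SB Espace.
Proof.
move=> a Sa; apply/subvP => _ /memv_imgP[x /mem_EP xE ->]; apply/mem_EP => b Sb.
rewrite dsum_modE act_DP1_p1t // xE ?SB_comp // [act _ _ x.2]act_Kla //=.
by rewrite coef_comp // mulrA.
Qed.

(** * The exact sequence *)

Notation fmap := (fmap K r p d la).
Notation gmap := (gmap K r p d la).

Lemma val_fmap u : vsval (fmap u) = (vsval u, 0).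
Proof.
rewrite fmapE vsprojK //; apply/mem_EP => a Sa /=.
by have /mem_UP -> := subvsP u; rewrite ?mulr0.
Qed.

Lemma is_lmod_U : is_lmod SB (U_ K r p d la).
Proof. by apply: submod_lmod U_submod; apply: DP1_lmod. Qed.

Lemma is_lmod_E : is_lmod SB (E_ K r p d la).
Proof.
by apply: submod_lmod E_submod; apply: dsum_lmod; [apply: DP1_lmod|apply: Kla_lmod].
Qed.

Lemma fg_short_exact : short_exact SB fmap gmap.
Proof.
split.
- by split; [apply: is_lmod_U | apply: is_lmod_E | apply: Kla_lmod].
- move=> a Sa; apply/lfunP => u; rewrite !comp_lfunE; apply: subvs_inj.
  rewrite val_fmap (val_submod_act _ U_submod) // (val_submod_act _ E_submod) //.
  by rewrite val_fmap dsum_modE /= linear0.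
- move=> a Sa; apply/lfunP => x; rewrite !comp_lfunE !gmapE.
  by rewrite (val_submod_act _ E_submod) // dsum_modE.
split.
- apply/eqP/lker0P => u v eq_uv; apply: subvs_inj.
  by have := congr1 (fun x => (vsval x).1) eq_uv; rewrite !val_fmap.
- apply/vspaceP => x; apply/memv_imgP/idP => [[u _ ->]|].
    by rewrite memv_ker gmapE val_fmap.
  rewrite memv_ker gmapE => /eqP x2.
  have Ux : (vsval x).1 \in Uspace.
    have /mem_EP xE := subvsP x; apply/mem_UP => a Sa.
    by rewrite xE // x2 mulr0.
  exists (Subvs Ux); rewrite ?memvf //; apply: subvs_inj.
  by rewrite val_fmap /= [LHS]surjective_pairing x2.
- apply/vspaceP => c; rewrite memvf; apply/memv_imgP.
  pose z : DPK K r p d la := ((c : K) *: zvec K p d la (lidx r la), c).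
  have Ez : z \in Espace by rewrite mem_Espace subrr mem0v.
  by exists (Subvs Ez); rewrite ?memvf // gmapE.
Qed.

(** A section would give a functional of weight [n], killed by all
    [E (wt e) n], hence vanishing on the [G e n], whose sum is [p1t (E n n)]. *)
Lemma not_splits : ~ splits SB gmap.
Proof.
case=> s [hom_s gs1]; pose x := vsval (s (1 : K)).
have x2 : x.2 = 1 by rewrite /x -gmapE -comp_lfunE gs1 lfunE.
have /mem_EP xE : x \in Espace := subvsP _.
have := xE \1%VF (SB_one r Kinf).
rewrite comp_lfun1r p1t_E // linear_sum big1 => [|e _].
  by rewrite coef_one x2 mulr1 => /eqP; rewrite eq_sym oner_eq0.
have act0 : act (Kla K r la) (E (wt e) n) (1 : K) = 0.
  rewrite act_Kla ?mem_SB_E // coef_E ?leqnn ?n_le_r //.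
  by rewrite gtn_eqF ?wt_lt // mul0r.
have /lfunP/(_ (1 : K)) := hom_s (E (wt e) n) (mem_SB_E r Kinf _ _).
rewrite comp_lfunE act0 linear0 => /esym/(congr1 (fun y => (vsval y).1)).
rewrite comp_lfunE (val_submod_act _ E_submod) ?mem_SB_E // dsum_modE /= -/x.
move/lfunP/(_ (G e (wt e))); rewrite act_DP1 ract_G eqxx leqnn subnn bin0 scale1r.
by rewrite lfunE /= linearZ => /= ->; rewrite scaler0.
Qed.

(** * The socle of U, and indecomposability *)

Lemma act_E_G (psi : DP1) t u e s : act DP1 (E t u) psi (G e s) =
  if (s == t) && (wt e <= t)%N
  then ('C(u - wt e, t - wt e))%:R * (psi (G e u) : K) else 0 :> K.
Proof.
by rewrite act_DP1 ract_G; case: ifP => _; [rewrite linearZ | rewrite linear0].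
Qed.

Lemma wt_inj e e' : wt e = wt e' -> e = e'.
Proof.
move=> eq_w; apply: val_inj.
by have [/wt_lt_wt|/wt_lt_wt|//] := ltngtP e e'; rewrite eq_w ltnn.
Qed.

Lemma leq_wt e e' : (wt e' <= wt e)%N = (e <= e')%N.
Proof.
have [lt_e|lt_e|/val_inj ->] := ltngtP e e'; last exact: leqnn.
  exact/ltnW/wt_lt_wt.
by rewrite leqNgt wt_lt_wt.
Qed.

Definition delta e : DP1 := Gdual e (wt e).

Lemma delta_G e e' s : delta e (G e' s) = ((e == e') && (wt e == s))%:R.
Proof. by rewrite Gdual_G // leqnn wt_le_r. Qed.

Lemma delta_U e : delta e \in Uspace.
Proof.
apply/mem_U => s /andP[le_n _]; rewrite Gdual_p1t ?leqnn ?wt_le_r //.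
by rewrite ltn_eqF // (leq_trans (wt_lt e)).
Qed.

(** The [delta e] span the socle of [DP1]. A vector [psi] of weight [wt e] has
    coordinates at the [G e' (wt e)] with [wt e' <= wt e] only, and for
    [wt e' < wt e] this coordinate is also one of [E (wt e') (wt e)] applied to
    [psi]. *)
Lemma socle_line (psi : DP1) e :
    act DP1 (E (wt e) (wt e)) psi = psi ->
    (forall t, (t < wt e)%N -> act DP1 (E t (wt e)) psi = 0) ->
  psi = (psi (G e (wt e)) : K) *: delta e.
Proof.
move=> wt_psi soc_psi; apply: DP1_ext => // e' s; rewrite scale_lfunE delta_G.
have [<-|ne_e] := eqVneq e e'.
  have [<-|ne_s] := eqVneq (wt e) s; first by rewrite [RHS]mulr1.
  by rewrite scaler0 -wt_psi act_E_G eq_sym (negbTE ne_s).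
rewrite scaler0 -wt_psi act_E_G; case: andP => // -[_ le_w].
have /soc_psi : (wt e' < wt e)%N.
  by rewrite ltn_neqAle le_w andbT; apply: contra ne_e => /eqP/wt_inj ->.
move/lfunP/(_ (G e' (wt e'))); rewrite act_E_G eqxx leqnn subnn bin0 mul1r lfunE /=.
by move->; rewrite mulr0.
Qed.

Lemma act_delta e t : act DP1 (E t (wt e)) (delta e) =
  if t == wt e then delta e else 0.
Proof.
apply: DP1_ext => // e' s; rewrite act_E_G delta_G eqxx andbT.
have [<-|ne_e] := eqVneq e e'; last first.
  by rewrite mulr0 if_same; case: ifP; rewrite ?lfunE // delta_G (negbTE ne_e).
have [->|ne_t] := eqVneq t (wt e).
  rewrite delta_G eqxx leqnn subnn bin0 mul1r andbT eq_sym /=.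
  by case: eqP.
rewrite lfunE /=; case: andP => // -[_ le_t]; rewrite bin_small ?mul0r //.
by rewrite subnn subn_gt0 ltn_neqAle eq_sym ne_t.
Qed.

(** [E (wt e) n] reads off one coordinate in weight [n]: the contribution of
    [e' > e] carries the binomial ['C(p ^ e', p ^ e)], zero in [K]. *)
Lemma act_E_n (psi : DP1) e :
  act DP1 (E (wt e) n) psi = (psi (G e n) : K) *: delta e.
Proof.
apply: DP1_ext => // e' s; rewrite act_E_G scale_lfunE delta_G.
have [<-|ne_e] := eqVneq e e'.
  rewrite leqnn andbT subnn bin0 mul1r eq_sym.
  by case: eqP => _; rewrite ?scaler0 // [RHS]mulr1.
rewrite scaler0; case: andP => // -[_ le_w].
have lt_e : (e < e')%N by rewrite ltn_neqAle -leq_wt le_w andbT.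
rewrite -bin_sub ?leq_sub2r //; last by rewrite (ltnW (wt_lt e)).
have -> : (n - wt e' - (wt e - wt e') = p ^ e)%N.
  by rewrite -(wtK e); have := wt_lt e; lia.
by rewrite wtK bin_pexp_lt ?mul0r.
Qed.

Notation U := (U_ K r p d la).

Lemma val_act_U a (u : U) : a \in SB ->
  vsval (act U a u) = act DP1 a (vsval u).
Proof. exact: val_submod_act U_submod. Qed.

Definition Udelta e : U := Subvs (delta_U e).

Lemma delta_neq0 e : Udelta e != 0.
Proof.
apply/eqP => /(congr1 vsval)/lfunP/(_ (G e (wt e))).
by rewrite /= delta_G !eqxx lfunE /= => /eqP; rewrite oner_eq0.
Qed.

(** Among the coordinates of a nonzero vector at a weight [s] take the one with
    the largest [e], whose generator has the smallest weight: moving to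
    weight [wt e] leaves only this coordinate. *)
Lemma submod_socle (W : {vspace U}) : is_submod SB W -> W <> 0%VS ->
  exists e, Udelta e \in W.
Proof.
move=> subW nzW; pose w := vpick W; pose psi : DP1 := vsval w.
have [[e0 s] nz_psi] : exists es : 'I_d.+1 * nat, psi (G es.1 es.2) != 0.
  apply: contrapT => /forallNP psi0; apply/nzW/eqP; rewrite -vpick0.
  apply/eqP/subvs_inj.
  apply: DP1_eq0 => // e s; apply/eqP/negPn/negP; exact: (psi0 (e, s)).
have [e nz_e max_e] := @arg_maxnP _ e0 (fun e => psi (G e s) != 0) val nz_psi.
exists e.
have act_w : act U (E (wt e) s) w = (psi (G e s) : K) *: Udelta e.
  apply: subvs_inj; rewrite val_act_U ?mem_SB_E //; apply: DP1_ext => // e' t.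
  rewrite act_E_G linearZ /= scale_lfunE delta_G.
  have [<-|ne_e] := eqVneq e e'.
    rewrite leqnn subnn bin0 mul1r andbT eq_sym.
    by case: eqP => _; rewrite ?scaler0 // [RHS]mulr1.
  rewrite scaler0; case: andP => // -[_]; rewrite leq_wt => le_e.
  have [->|/max_e le_e'] := eqVneq (psi (G e' s)) 0; first exact: mulr0.
  by case/eqP: ne_e; apply/val_inj/eqP; rewrite eqn_leq le_e.
have : act U (E (wt e) s) w \in W.
  by apply/(subvP (subW _ (mem_SB_E r Kinf _ _)))/memv_img/memv_pick.
by rewrite act_w rpredZeq (negbTE nz_e).
Qed.

(** Each [delta e] is an eigenvector, by [socle_line]. The eigenvalues agree since
    the coordinates in weight [n] of a vector of [U] sum to zero: the form with
    the coordinates 1 and -1 at [G e n] and [G e' n] lies in [U], and so does its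
    image, which has the coordinates [c e] and [- c e'] there. *)
Lemma endo_scalar (phi : 'End(U)) : is_lmod_hom SB phi ->
  exists c : K, forall e, phi (Udelta e) = c *: Udelta e.
Proof.
move=> hom_phi.
have phi_act a u : a \in SB -> phi (act U a u) = act U a (phi u).
  by move=> Sa; rewrite -!comp_lfunE hom_phi.
pose c e : K := (vsval (phi (Udelta e)) : DP1) (G e (wt e)).
have phi_delta e : phi (Udelta e) = c e *: Udelta e.
  apply: subvs_inj; rewrite linearZ /=.
  have act_phi t : act DP1 (E t (wt e)) (vsval (phi (Udelta e))) =
      vsval (phi (if t == wt e then Udelta e else 0)).
    rewrite -val_act_U ?mem_SB_E // -phi_act ?mem_SB_E //; congr (vsval (phi _)).
    apply: subvs_inj; rewrite val_act_U ?mem_SB_E // [LHS]act_delta.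
    by case: ifP.
  apply: socle_line => [|t lt_t]; first by rewrite act_phi eqxx.
  by rewrite act_phi ltn_eqF // !linear0.
suff c_const e e' : c e = c e'.
  by exists (c ord0) => e; rewrite phi_delta (c_const e ord0).
pose v0 : DP1 := Gdual e n - Gdual e' n.
have le_n e1 : (wt e1 <= n <= r)%N by rewrite (ltnW (wt_lt e1)) n_le_r.
have Uv0 : v0 \in Uspace.
  apply/mem_U => s /andP[le_ns _]; rewrite add_lfunE opp_lfunE !Gdual_p1t //.
  by case: eqP => _; rewrite /p1_coef ?subnn ?binn subrr.
pose v : U := Subvs Uv0; pose w : DP1 := vsval (phi v).
have wE e1 : w (G e1 n) = c e1 * ((e == e1)%:R - (e' == e1)%:R) :> K.
  have : act DP1 (E (wt e1) n) w = (v0 (G e1 n) : K) *: (c e1 *: delta e1).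
    rewrite -val_act_U ?mem_SB_E // -phi_act ?mem_SB_E //.
    have -> : act U (E (wt e1) n) v = (v0 (G e1 n) : K) *: Udelta e1.
      by apply: subvs_inj; rewrite val_act_U ?mem_SB_E // act_E_n linearZ.
    by rewrite linearZ /= phi_delta !linearZ.
  rewrite act_E_n => /lfunP/(_ (G e1 (wt e1))).
  rewrite !scale_lfunE delta_G !eqxx add_lfunE opp_lfunE !Gdual_G // !eqxx !andbT.
  by rewrite [LHS]mulr1 => ->; rewrite [c e1 *: _]mulr1 [LHS]mulrC.
have /mem_U/(_ n) : w \in Uspace := subvsP _.
rewrite leqnn n_le_r => /(_ isT).
rewrite p1t_E // linear_sum.
rewrite (eq_bigr (fun e1 => c e1 * (e == e1)%:R - c e1 * (e' == e1)%:R)).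
  rewrite sumrB (bigD1 e) //= big1 ?addr0; last first.
    by move=> e1 ne_e1; rewrite eq_sym (negbTE ne_e1) mulr0.
  rewrite (bigD1 e') //= big1 ?addr0; last first.
    by move=> e1 ne_e1; rewrite eq_sym (negbTE ne_e1) mulr0.
  by rewrite !eqxx !mulr1 => /eqP; rewrite subr_eq0 => /eqP.
by move=> e1 _; rewrite linearZ /= wE /p1_coef subnn binn -mulrBr [LHS]mul1r.
Qed.

Lemma U_indecomposable : indecomposable SB U.
Proof.
split=> [U0|W1 W2 sub1 sub2 sumW capW].
  by have := delta_neq0 ord0; rewrite -memv0 -U0 memvf.
pose pi := daddv_pi W1 W2.
have pi1 u : u \in W1 -> pi u = u by apply: daddv_pi_id.
have pi_add u : pi u + daddv_pi W2 W1 u = u.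
  by rewrite daddv_pi_add // sumW memvf.
have pi2 u : u \in W2 -> pi u = 0.
  move=> W2u; have := pi_add u; rewrite (daddv_pi_id _ W2u) 1?capvC //.
  by move/eqP; rewrite -subr_eq0 addrK => /eqP.
have hom_pi : is_lmod_hom SB pi.
  move=> a Sa; apply/lfunP => u; rewrite !comp_lfunE.
  have act1 : act U a (pi u) \in W1.
    by apply/(subvP (sub1 a Sa))/memv_img/memv_pi.
  have act2 : act U a (daddv_pi W2 W1 u) \in W2.
    by apply/(subvP (sub2 a Sa))/memv_img/memv_pi.
  have -> : act U a u = act U a (pi u) + act U a (daddv_pi W2 W1 u).
    by rewrite -linearD pi_add.
  have piD v v' : pi (v + v') = pi v + pi v' by rewrite linearD.
  by rewrite piD (pi1 _ act1) (pi2 _ act2) addr0.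
have [c pi_delta] := endo_scalar hom_pi.
have [c0|nz_c] := eqVneq c 0; [left|right]; apply: contrapT.
  case/(submod_socle sub1) => e /pi1; rewrite pi_delta c0 scale0r => /esym/eqP.
  by rewrite (negbTE (delta_neq0 e)).
case/(submod_socle sub2) => e /pi2; rewrite pi_delta => /eqP.
by rewrite scaler_eq0 (negbTE nz_c) (negbTE (delta_neq0 e)).
Qed.

(** * Lifting homomorphisms to the middle term *)

(** The maps [E m n] with [m < n] are generated by those with [n - m] a power
    of [p]: some ['C(n - m, p ^ e)] is nonzero in [K], namely for [p ^ e] the
    largest power of [p] that is at most [n - m]. *)
Lemma E_factor m : (m < n)%N ->
  exists e (a : 'End(tens K r)), a \in SB /\ E m n = (a \o E (wt e) n)%VF.
Proof.
move=> lt_mn; set k := (n - m)%N; have k_gt0 : (0 < k)%N by rewrite subn_gt0.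
have p_gt1 := prime_gt1 (pcharf_prime charK).
pose t := trunc_log p k.
have /andP[le_tk lt_k] : (p ^ t <= k < p ^ t.+1)%N.
  by rewrite trunc_logP ?trunc_log_ltn.
have lt_t : (t < d.+1)%N.
  rewrite -(ltn_exp2l _ _ p_gt1); apply: leq_ltn_trans le_tk _.
  by case/andP: d_la => _; apply: leq_ltn_trans; apply: leq_subr.
pose e := Ordinal lt_t.
have le_m : (m <= wt e)%N by move: le_tk; rewrite /wt /k /=; lia.
have nz_bin : ('C(k, p ^ t))%:R != 0 :> K.
  rewrite bin_pexp // -(dvdn_pcharf charK) gtnNdvd //.
    by rewrite divn_gt0 // expn_gt0 p_gt0.
  by rewrite ltn_divLR ?expn_gt0 ?p_gt0 // -expnS.
exists e, (('C(k, p ^ t))%:R^-1 *: E m (wt e)); rewrite memvZ ?mem_SB_E //; split=> //.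
rewrite -comp_lfunZl E_comp // -/k.
rewrite (_ : 'C(k, wt e - m) = 'C(k, p ^ t)) ?scalerA ?mulVf ?scale1r //.
rewrite -[RHS]bin_sub //; congr binomial; move: le_tk le_m; rewrite /k /wt /=.
by have := pe_le e; rewrite /=; lia.
Qed.

Lemma hom_Kla_act (X : actType (tens K r)) (h : 'Hom(X, Kla K r la)) a x :
    is_lmod_hom SB h -> a \in SB ->
  h (act X a x) = (coef n n a : K) * (h x : K) :> K.
Proof.
by move=> hom_h Sa; rewrite -[LHS]comp_lfunE hom_h // comp_lfunE act_Kla.
Qed.

(** Otherwise the component [x] of [w] of weight [n] is killed by all [E m n] with
    [m < n], by [E_factor], so that its line is a submodule. It is a complement
    of the kernel of [h], which is then zero. *)
Lemma vanish_on_killed (X : actType (tens K r)) (h : 'Hom(X, Kla K r la)) :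
    is_lmod SB X -> indecomposable SB X -> is_lmod_hom SB h ->
    ~ is_lmod_iso SB h ->
  forall w, (forall e, act X (E (wt e) n) w = 0) -> h w = 0.
Proof.
move=> [XD _ XM] [_ X_indec] hom_h not_iso.
have h_act a x := @hom_Kla_act X h a x hom_h.
have SE t s : E t s \in SB := mem_SB_E r Kinf t s.
have En : coef n n (E n n) = 1 :> K by rewrite coef_E ?leqnn ?n_le_r // eqxx.
have act0 x : act X 0 x = 0.
  have := XD 1 0 0 (mem0v _) (mem0v _); rewrite !scale1r addr0 -[X in X = _]addr0.
  by move/addrI <-; rewrite lfunE.
move=> w w0; apply: contrapT => nz_hw; pose x := act X (E n n) w.
have hx : h x = h w by rewrite /x h_act // En mul1r.
have actEx t s : act X (E t s) x = if s == n then act X (E t n) w else 0.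
  rewrite /x -comp_lfunE -XM //; case: eqP => [->|/eqP ne_s]; first by rewrite E_idr.
  by rewrite E_comp_ne.
have act_x a : a \in SB -> act X a x = (coef n n a : K) *: x.
  move=> Sa; suff [] : a \in SB /\ act X a x = (coef n n a : K) *: x by [].
  elim/SB_ind: a / Sa => [c a1 a2 [S1 IH1] [S2 IH2]|t s].
    split; first by rewrite memvD ?memvZ.
    by rewrite XD // add_lfunE scale_lfunE IH1 IH2 linearP scalerA -scalerDl.
  split=> //; rewrite actEx; have [->|ne_s] := eqVneq s n; last first.
    by rewrite coef_E ?leqnn ?n_le_r // [n == s]eq_sym (negbTE ne_s) andbF scale0r.
  have [lt_tn|lt_nt|->] := ltngtP t n; last by rewrite En scale1r.
    case: (E_factor lt_tn) => e [a1 [Sa1 ->]]; rewrite XM // comp_lfunE.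
    rewrite w0 linear0 coef_comp // [X in (_ * X : K)]coef_E ?leqnn ?n_le_r //.
    by rewrite gtn_eqF ?wt_lt // mulr0 scale0r.
  by rewrite E_out ?act0 ?linear0 ?scale0r // leqNgt lt_nt.
have hxv c : h (c *: x) = c * (h w : K) :> K by rewrite linearZ /= hx.
have sub1 : is_submod SB <[x]>%VS.
  move=> a Sa; apply/subvP => _ /memv_imgP[_ /vlineP[c ->] ->].
  by rewrite linearZ /= act_x // !memvZ ?memv_line.
have sub2 : is_submod SB (lker h).
  move=> a Sa; apply/subvP => _ /memv_imgP[v hv ->]; rewrite memv_ker in hv.
  by rewrite memv_ker h_act // (eqP hv) mulr0.
have nz_h : (h w : K) != 0 by apply/eqP.
have sum12 : (<[x]> + lker h = fullv)%VS.
  apply/eqP; rewrite eqEsubv subvf /=; apply/subvP => v _.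
  pose c : K := (h v : K) / (h w : K).
  rewrite -[v](subrK (c *: x)) addrC memv_add ?memvZ ?memv_line //.
  by rewrite memv_ker linearB /= hxv divfK // subrr.
have cap12 : (<[x]> :&: lker h = 0)%VS.
  apply/eqP; rewrite -subv0; apply/subvP => v; rewrite memv_cap memv_ker memv0.
  case/andP => /vlineP[c ->]; rewrite hxv mulf_eq0 (negbTE nz_h) orbF => /eqP ->.
  by rewrite scale0r.
case: (X_indec _ _ sub1 sub2 sum12 cap12) => [x_0|/eqP/lker0P h_inj].
  have := memv_line x; rewrite x_0 memv0 => /eqP x0.
  by case/eqP: nz_h; rewrite -hx x0 linear0.
apply: not_iso; split=> //.
exists (linfun (fun c : Kla K r la => ((c : K) / (h w : K)) *: x)).
set k := linfun _; have kE c : k c = ((c : K) / (h w : K)) *: x.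
  rewrite linfunE // => b u v; rewrite mulrDl scalerDl scalerA.
  by congr (_ *: _ + _); apply/esym/mulrA.
have hk c : h (k c) = c by rewrite kE hxv divfK.
split; last by apply/lfunP => c; rewrite comp_lfunE hk lfunE.
  move=> a Sa; apply/lfunP => c; rewrite !comp_lfunE; apply: h_inj.
  by rewrite hk h_act // hk act_Kla.
by apply/lfunP => v; apply: h_inj; rewrite comp_lfunE hk lfunE.
Qed.

Lemma lift_through_g (X : actType (tens K r)) (h : 'Hom(X, Kla K r la)) :
    is_lmod SB X -> indecomposable SB X -> is_lmod_hom SB h ->
    ~ is_lmod_iso SB h ->
  exists k : 'Hom(X, E_ K r p d la), is_lmod_hom SB k /\ h = (gmap \o k)%VF.
Proof.
move=> lmodX X_indec hom_h not_iso; have [XD _ XM] := lmodX.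
have h_act a x := @hom_Kla_act X h a x hom_h.
have SE t s : E t s \in SB := mem_SB_E r Kinf t s.
pose T : 'Hom(X, {ffun 'I_d.+1 -> X}) :=
  linfun (fun x => [ffun e => act X (E (wt e) n) x]).
have TE x : T x = [ffun e => act X (E (wt e) n) x].
  by rewrite linfunE // => c u v; apply/ffunP => e; rewrite !ffunE linearP.
have kerT w : T w = 0 -> h w = 0.
  move=> Tw; apply: (vanish_on_killed lmodX X_indec hom_h not_iso) => e.
  by have := congr1 (fun f : {ffun 'I_d.+1 -> X} => f e) Tw; rewrite TE !ffunE.
(* The vectors [x] and [T^-1 (T x)] differ by an element of the kernel of [T],
   where [h] vanishes. *)
pose theta : 'Hom({ffun 'I_d.+1 -> X}, K^o) := (h \o T^-1)%VF.
have thetaT x : theta (T x) = h x.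
  apply/eqP; rewrite comp_lfunE -subr_eq0 -linearB; apply/eqP/kerT.
  by rewrite linearB /= limg_lfunVK ?subrr // memv_img ?memvf.
pose F x (v : subvs_of P1) := [ffun e => act X (vsval v e) x].
pose kappa x : DP1 := linfun (fun v => theta (F x v)).
have kappaE x v : kappa x v = theta (F x v).
  rewrite linfunE // => c u u'; rewrite -linearP; congr (theta _).
  apply/ffunP => e; rewrite !ffunE (XD c _ _ (P1_SB u e) (P1_SB u' e)).
  by rewrite add_lfunE scale_lfunE.
have kappa_lin c x y : kappa (c *: x + y) = c *: kappa x + kappa y.
  apply/lfunP => v; rewrite add_lfunE scale_lfunE !kappaE -linearP.
  by congr (theta _); apply/ffunP => e; rewrite !ffunE linearP.
have kappa_act a x : a \in SB -> kappa (act X a x) = act DP1 a (kappa x).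
  move=> Sa; apply/lfunP => v; rewrite act_DP1 !kappaE; congr (theta _).
  apply/ffunP => e; rewrite !ffunE val_ract // ffunE XM ?P1_SB //.
  by rewrite comp_lfunE.
pose K2 x : DPK K r p d la := (kappa x, h x).
have K2_E x : K2 x \in Espace.
  apply/mem_EP => a Sa /=; rewrite -h_act // -thetaT kappaE; congr (theta _).
  rewrite TE; apply/ffunP => e; rewrite !ffunE val_p1t ?SB_comp // ffunE.
  by rewrite comp_lfunA E_idr XM // comp_lfunE.
exists (linfun (fun x => Subvs (K2_E x))).
set k := linfun _; have kE x : vsval (k x) = K2 x.
  rewrite linfunE // => c u v; apply: subvs_inj; rewrite linearP /=.
  by congr pair; rewrite /= ?kappa_lin ?linearP.
split=> [a Sa|]; apply/lfunP => x; rewrite !comp_lfunE ?gmapE ?kE //.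
apply: subvs_inj; rewrite (val_submod_act _ E_submod) // !kE dsum_modE.
congr pair; rewrite /= ?kappa_act // h_act //.
by rewrite [RHS]act_Kla.
Qed.

End ProjectiveModule.

Theorem theorem5p2 (K : fieldType) (p r d : nat) (la : nat * nat)
    (Kinf : ~ cardinality.finite_set (@classical_sets.setT K))
    (charK : p \in [pchar K])
    (r_ge1 : (1 <= r)%N)
    (la_r : (la.1 + la.2)%N = r)
    (la2_neq0 : la.2 <> 0%N)
    (d_la : (p ^ d <= la.2 < p ^ d.+1)%N) :
  [/\ is_submod (SB K r) (Uspace K r p d la),
      is_submod (SB K r) (Espace K r p d la)
    & auslander_reiten (SB K r) (fmap K r p d la) (gmap K r p d la)].
Proof.
split; [exact: U_submod | exact: E_submod | split].
- exact: fg_short_exact.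
- exact: (not_splits Kinf charK la_r d_la).
- by apply: dim1_indecomposable; rewrite dimvf.
- exact: U_indecomposable.
- by move=> X lmodX indX h hom_h not_iso; apply: lift_through_g.
Qed.
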